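(* Let $n\ge 5$ and let $P=P(m_1,\dots,m_{n-1})$ be a natural unit interval order with $m_1=r\ge 2$, $m_2=\cdots=m_s=n-1$ and $m_{s+1}=\cdots=m_{n-1}=n$ for some $s$ with $r<s<n-1$. Let $G=\mathrm{inc}(P)$. Then, with $A=\{1^n,2^11^{n-2},2^21^{n-4},3^11^{n-3}\}$ and $A'=\{(n-2,1,1),(n-2,2),(n-1,1),(n)\}$, $$X_G(\mathbf{x},t)=\sum_{\lambda\in A}B_\lambda(t)s_\lambda=\sum_{\mu\in A'}C_\mu(t)e_\mu,$$ where $B_\lambda(t)=\sum_{T}t^{\mathrm{inv}_G(T)}$, summed over all $P$-tableaux $T$ of shape $\lambda$, and $C_{(n-2,1,1)}(t)=B_{3^11^{n-3}}(t)$, $C_{(n-2,2)}(t)=B_{2^21^{n-4}}(t)-B_{3^11^{n-3}}(t)$, $C_{(n-1,1)}(t)=B_{2^11^{n-2}}(t)-B_{2^21^{n-4}}(t)-B_{3^11^{n-3}}(t)$, $C_n(t)=B_{1^n}(t)-B_{2^11^{n-2}}(t)+B_{3^11^{n-3}}(t)$. Moreover these four $C_\mu(t)$ are polynomials in $t$ with nonnegative coefficients; consequently $X_G(\mathbf{x},t)$ is $e$-positive.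
   Context: A natural unit interval order $P(m_1,\dots,m_{n-1})$ is defined for integers $m_1\le\cdots\le m_{n-1}\le n$ with $m_i\ge i$: it is the poset on $[n]$ with $i<_P j$ iff $i<n$ and $j\in\{m_i+1,\dots,n\}$. Its incomparability graph $\mathrm{inc}(P)$ has vertex set $[n]$ and an edge $\{i,j\}$ ($i<j$) iff $j\le m_i$. The chromatic quasisymmetric function of a graph $G$ on $V\subset\mathbb{P}$ is $X_G(\mathbf{x},t)=\sum_\kappa t^{\mathrm{asc}(\kappa)}\prod_v x_{\kappa(v)}$ over proper colorings $\kappa:V\to\mathbb{P}$, with $\mathrm{asc}(\kappa)$ the number of edges $\{i,j\}$, $i<j$, with $\kappa(i)<\kappa(j)$. $s_\lambda$ and $e_\mu$ denote Schur and elementary symmetric functions. A $P$-tableau of shape $\lambda\vdash n$ is a filling $T=[a_{i,j}]$ of the Young diagram of $\lambda$ (English notation) using each element of $P$ exactly once, with $a_{i,j}<_P a_{i,j+1}$ and $a_{i+1,j}\not<_P a_{i,j}$ for all $i,j$. The shape $a^b1^c$ has $b$ rows of length $a$ followed by $c$ rows of length $1$. A $G$-inversion of $T$ is an edge $\{i,j\}$ of $G$ with $i<j$ and $i$ in a lower row than $j$; $\mathrm{inv}_G(T)$ is their number. *)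

(* Defs.v *)
From mathcomp Require Export all_boot all_order all_fingroup all_algebra.
From mathcomp.multinomials Require Export mpoly.
Unset Printing Implicit Defensive.
Import GRing.Theory.
Local Open Scope ring_scope.

Definition Plt (n : nat) (m : nat -> nat) (i j : nat) : bool :=
  [&& (i < n)%N, (m i < j)%N & (j <= n)%N].

Definition incedge (m : nat -> nat) (i j : nat) : bool :=
  (i < j)%N && (j <= m i)%N.

(* Vertex v : 'I_n stands for the integer v+1 of [n]. A coloring with
   colors in {1..N} is represented by kappa : 'I_n -> 'I_N (color c <-> c+1). *)
Definition proper_col (n N : nat) (m : nat -> nat) (k : {ffun 'I_n -> 'I_N}) : bool :=
  [forall u : 'I_n, forall v : 'I_n,
     incedge m u.+1 v.+1 ==> (k u != k v)].

Definition asc (n N : nat) (m : nat -> nat) (k : {ffun 'I_n -> 'I_N}) : nat :=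
  #|[set uv : 'I_n * 'I_n | incedge m uv.1.+1 uv.2.+1 && (k uv.1 < k uv.2)%N]|.

Definition chromQ (n N : nat) (m : nat -> nat) : {mpoly {poly int}[N]} :=
  \sum_(k : {ffun 'I_n -> 'I_N} | proper_col n N m k)
     ((('X : {poly int}) ^+ asc n N m k) *: \prod_(v : 'I_n) 'X_(k v)).

Definition is_ssyt (T : seq (seq nat)) : bool :=
  all (fun row => sorted leq row) T &&
  all (fun i => all (fun j => (nth 0 (nth [::] T i) j < nth 0 (nth [::] T i.+1) j)%N)
                    (iota 0 (size (nth [::] T i.+1))))
      (iota 0 (size T).-1).

(* Schur polynomial s_la(x_1..x_N): sum over SSYT of shape la with entries
   in {1..N} (entry c+1 encoded by c : 'I_N); cells listed in row-reading order. *)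
Definition schur (N : nat) (la : seq nat) : {mpoly {poly int}[N]} :=
  \sum_(T : {ffun 'I_(sumn la) -> 'I_N}
          | is_ssyt (reshape la [seq val (T c) | c <- enum 'I_(sumn la)]))
     \prod_(c : 'I_(sumn la)) 'X_(T c).

Definition elem (N : nat) (mu : seq nat) : {mpoly {poly int}[N]} :=
  \prod_(k <- mu) mesym N {poly int} k.

Definition is_Ptableau (n : nat) (m : nat -> nat) (T : seq (seq nat)) : bool :=
  all (fun row => sorted (Plt n m) row) T &&
  all (fun i => all (fun j => ~~ Plt n m (nth 0 (nth [::] T i.+1) j) (nth 0 (nth [::] T i) j))
                    (iota 0 (size (nth [::] T i.+1))))
      (iota 0 (size T).-1).

Definition rowof (T : seq (seq nat)) (x : nat) : nat := find (fun row => x \in row) T.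

Definition invG (n : nat) (m : nat -> nat) (T : seq (seq nat)) : nat :=
  #|[set ab : 'I_n * 'I_n | incedge m ab.1.+1 ab.2.+1 &&
                            (rowof T ab.2.+1 < rowof T ab.1.+1)%N]|.

(* The filling of shape la (sumn la = n) whose row-reading word is
   s(0)+1, ..., s(n-1)+1; every filling of shape la using each element of
   [n] exactly once arises from exactly one permutation s. *)
Definition filling (n : nat) (la : seq nat) (s : 'S_n) : seq (seq nat) :=
  reshape la [seq (val (s i)).+1 | i <- enum 'I_n].

Definition Bpoly (n : nat) (m : nat -> nat) (la : seq nat) : {poly int} :=
  \sum_(s : 'S_n | is_Ptableau n m (filling n la s))
     ('X : {poly int}) ^+ invG n m (filling n la s).

(* Main.v *)
Require Import Defs.
From mathcomp Require Import ring zify.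
Set Implicit Arguments.
Unset Strict Implicit.
Unset Printing Implicit Defensive.
Import GRing.Theory.
Local Open Scope ring_scope.

(** The middle vertices [2 .. n - 1] of [G] form a clique of size [k = n - 2].
    Summing over the colourings of a clique, the weight of an extra vertex joined
    to an initial (or final) segment of it can be moved, by a telescoping identity,
    onto the first (or last) vertex of that segment.  Applied at vertex [1], at
    vertex [n], and again to the resulting end terms, this expresses the chromatic
    function through [e_k e_1^2], [e_k e_2], [e_(k+1) e_1] and [e_(k+2)] with
    explicit coefficients built from [t]-integers.  On the other side, a [P]-tableau
    of one of the four shapes is a word in the middle letters into which [1] and [n]
    are inserted, so the four tableau sums are explicit products of [t]-integers as
    well, and the four Schur functions are expanded in elementary ones by comparing
    columns.  Writing [p], [q] for the degrees of the vertices [1] and [n], the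
    coefficients [C] factor through [t]-integers in a manifestly positive way. *)

(** * Weighted sums over words *)

(** The letter weights [x] stay arbitrary throughout: a factor attached to each letter, such as its
    interaction with letters held fixed, is then only a change of [x], so a statement about a whole
    clique applies at once to a segment of one. Symmetrising a segment of j letters produces a
    factor [j]_t, and recovering the end term would mean dividing by it. The end-term identities are
    therefore stated after multiplication by [k]_t and [k-1]_t, which are cancelled at the end in an
    integral domain with nonzero t-integers. No bijection between colourings and tableaux is used:
    both sides are evaluated separately. Their agreement becomes a polynomial identity in t and the
    t-integers of three independent parameters once each power of t is replaced by t^j = 1 + (t -
    1)[j]_t. *)

Section WordSums.
Context {R : comNzRingType} (N : nat).
Implicit Types (x f : nat -> R) (F G : seq nat -> R) (w u : seq nat).

Fixpoint wsum x (k : nat) F : R :=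
  if k is k'.+1 then \sum_(0 <= c < N) x c * wsum x k' (fun w => F (c :: w))
  else F [::].

Lemma wsum_nil x F : wsum x 0 F = F [::].
Proof. by []. Qed.

Lemma wsumS x k F :
  wsum x k.+1 F = \sum_(0 <= c < N) x c * wsum x k (fun w => F (c :: w)).
Proof. by []. Qed.

Lemma eq_wsum x k F G :
  (forall w, size w = k -> F w = G w) -> wsum x k F = wsum x k G.
Proof.
elim: k F G => [|k IH] F G eqFG /=; first exact: eqFG.
by apply: eq_bigr => c _; rewrite (IH _ (fun w => G (c :: w))) // => w sw; rewrite eqFG //= sw.
Qed.

Lemma wsumD x k F G : wsum x k (fun w => F w + G w) = wsum x k F + wsum x k G.
Proof.
elim: k F G => //= k IH F G; rewrite -big_split /=.
by apply: eq_bigr => c _; rewrite IH mulrDr.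
Qed.

Lemma wsumZ a x k F : wsum x k (fun w => a * F w) = a * wsum x k F.
Proof.
elim: k F => //= k IH F; rewrite big_distrr /=.
by apply: eq_bigr => c _; rewrite IH mulrCA.
Qed.

Lemma wsumZr a x k F : wsum x k (fun w => F w * a) = wsum x k F * a.
Proof. by rewrite mulrC -wsumZ; apply: eq_wsum => w _; rewrite mulrC. Qed.

Lemma wsumB x k F G : wsum x k (fun w => F w - G w) = wsum x k F - wsum x k G.
Proof.
rewrite -[wsum x k G]mul1r -mulNr -wsumZ -wsumD.
by apply: eq_wsum => w _; rewrite mulN1r.
Qed.

Lemma wsum0 x k : wsum x k (fun=> 0) = 0.
Proof.
by elim: k => //= k IH; apply: big1 => c _; rewrite IH mulr0.
Qed.

Lemma wsum_sum (I : Type) (r : seq I) (P : pred I) x k (F : I -> seq nat -> R) :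
  wsum x k (fun w => \sum_(i <- r | P i) F i w) = \sum_(i <- r | P i) wsum x k (F i).
Proof.
elim: k F => //= k IH F; rewrite exchange_big /=.
by apply: eq_bigr => c _; rewrite -big_distrr /= -IH.
Qed.

Lemma wsum_cat x j k F :
  wsum x (j + k) F = wsum x j (fun u => wsum x k (fun w => F (u ++ w))).
Proof.
elim: j F => //= j IH F.
by apply: eq_bigr => c _; rewrite IH.
Qed.

Lemma wsum_swap x y j k (F : seq nat -> seq nat -> R) :
  wsum x j (fun u => wsum y k (fun w => F u w)) =
  wsum y k (fun w => wsum x j (fun u => F u w)).
Proof.
elim: j F => //= j IH F.
rewrite wsum_sum; apply: eq_bigr => c _.
by rewrite wsumZ IH.
Qed.

Lemma wsum_rcons x k F :
  wsum x k.+1 F = \sum_(0 <= c < N) x c * wsum x k (fun w => F (rcons w c)).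
Proof.
rewrite -addn1 wsum_cat /= wsum_sum; apply: eq_bigr => c _.
by rewrite wsumZ; congr (_ * _); apply: eq_wsum => w _; rewrite cats1.
Qed.

Lemma wsum_rev x k F : wsum x k F = wsum x k (fun w => F (rev w)).
Proof.
elim: k F => //= k IH F.
rewrite -/(wsum x k.+1 (fun w => F (rev w))) wsum_rcons.
by apply: eq_bigr => c _; rewrite IH; congr (_ * _); apply: eq_wsum => w _; rewrite rev_rcons.
Qed.

(** The device behind all later changes of weight: interactions with fixed letters disappear into
    [x]. *)
Lemma wsum_prod x f k F :
  wsum x k (fun w => F w * \prod_(c <- w) f c) = wsum (fun c => x c * f c) k F.
Proof.
elim: k F => [|k IH] F /=; first by rewrite big_nil mulr1.
apply: eq_bigr => c _; rewrite -IH -mulrA -[in RHS]wsumZ; congr (_ * _).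
by apply: eq_wsum => w _; rewrite big_cons mulrCA.
Qed.

End WordSums.
Arguments wsum : simpl never.

(** * Elementary symmetric functions *)

Section Esym.
Context {R : comNzRingType}.

(** The recursion adds the variable of largest index: the ascent weight between the largest colour
    and a smaller one is constant, so inductions on [N] close. *)
Fixpoint elsym (N : nat) (x : nat -> R) k : R :=
  match k, N with
  | 0%N, _ => 1
  | _.+1, 0%N => 0
  | k'.+1, N'.+1 => elsym N' x k + x N' * elsym N' x k'
  end.

Lemma elsym0 N x : elsym N x 0 = 1.
Proof. by case: N. Qed.

Lemma elsymS N x k : elsym N.+1 x k.+1 = elsym N x k.+1 + x N * elsym N x k.
Proof. by []. Qed.

Lemma elsym_nil x k : elsym 0 x k.+1 = 0.
Proof. by []. Qed.

Lemma eq_elsym N x y k :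
  (forall c, (c < N)%N -> x c = y c) -> elsym N x k = elsym N y k.
Proof.
elim: N k => [|N IH] [|k] // eqxy; rewrite !elsymS eqxy //.
by rewrite !IH // => c ltcN; rewrite eqxy // ltnW.
Qed.

Lemma elsymZ N (t : R) x k : elsym N (fun c => t * x c) k = t ^+ k * elsym N x k.
Proof.
elim: N k => [|N IH] [|k]; rewrite ?elsym0 ?expr0 ?mulr1 //; first by rewrite mulr0.
by rewrite !elsymS !IH exprS; ring.
Qed.

End Esym.
Arguments elsym : simpl never.

(** * Symmetrisation over cliques *)

Section Clique.
Context {R : comNzRingType}.
Implicit Types (g : nat -> nat -> R) (w u : seq nat).

Fixpoint pairw g w : R :=
  if w is c :: w' then (\prod_(d <- w') g c d) * pairw g w' else 1.

Lemma pairw_cat g u w :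
  pairw g (u ++ w) = pairw g u * pairw g w * \prod_(c <- u) \prod_(d <- w) g c d.
Proof.
elim: u => [|c u IH] /=; first by rewrite big_nil mul1r mulr1.
by rewrite big_cons big_cat IH /=; ring.
Qed.

Lemma pairw_rcons g u d :
  pairw g (rcons u d) = pairw g u * \prod_(c <- u) g c d.
Proof.
rewrite -cats1 pairw_cat /= big_nil !mulr1; congr (_ * _).
by apply: eq_bigr => c _; rewrite big_seq1.
Qed.

Lemma pairw_rev g w : pairw g (rev w) = pairw (fun c d => g d c) w.
Proof.
elim: w => //= c w IH; rewrite rev_cons pairw_rcons IH mulrC; congr (_ * _).
by rewrite (perm_big w) //= perm_rev.
Qed.

Fixpoint qnum (t : R) k : R := if k is k'.+1 then qnum t k' + t ^+ k' else 0.
Fixpoint qfact (t : R) k : R := if k is k'.+1 then qfact t k' * qnum t k else 1.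

Lemma qnum0 t : qnum t 0 = 0. Proof. by []. Qed.
Lemma qnumS t k : qnum t k.+1 = qnum t k + t ^+ k.
Proof. by []. Qed.
Lemma qnumSl t k : qnum t k.+1 = 1 + t * qnum t k.
Proof.
elim: k => [|k IH]; first by rewrite qnumS qnum0 expr0; ring.
by rewrite qnumS [in LHS]IH qnumS exprS; ring.
Qed.
Lemma qnumD t j k : qnum t (j + k) = qnum t j + t ^+ j * qnum t k.
Proof.
elim: k => [|k IH]; first by rewrite addn0 qnum0 mulr0 addr0.
by rewrite addnS !qnumS IH exprD; ring.
Qed.
(** Trades powers with a symbolic exponent for t-integers; the coefficient identities then become
    polynomial ones within reach of [ring]. *)
Lemma expr_qnum t k : t ^+ k = 1 + (t - 1) * qnum t k.
Proof.
by elim: k => [|k IH]; rewrite ?qnum0 ?mulr0 ?addr0 ?expr0 // exprS qnumSl IH; ring.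
Qed.
Lemma qfact0 t : qfact t 0 = 1. Proof. by []. Qed.
Lemma qfactS t k : qfact t k.+1 = qfact t k * qnum t k.+1.
Proof. by []. Qed.

Arguments qnum : simpl never.
Arguments qfact : simpl never.

(* [exch g] is the telescoping identity which moves the factors of an extra
   letter [a] against a clique onto a single letter of that clique. *)
Definition exch N g := forall (x : nat -> R) a k, (a < N)%N ->
  elsym N (fun c => x c * g a c) k.+1 - elsym N x k.+1 =
  \sum_(0 <= c < N) x c * (g a c - 1) * elsym N (fun d => x d * g c d) k.

(** For the ascent weight this is a count on each set of [k.+1] colours: the chosen first colour is
    weighted by t to the number of larger ones, and the choices sum to a t-integer. *)
Definition graded N t g := forall (x : nat -> R) k,
  \sum_(0 <= c < N) x c * elsym N (fun d => x d * g c d) k = qnum t k.+1 * elsym N x k.+1.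

Lemma wsum_pairw N t g x k : graded N t g ->
  wsum N x k (pairw g) = qfact t k * elsym N x k.
Proof.
move=> gr; elim: k x => [|k IH] x; first by rewrite wsum_nil qfact0 elsym0 mulr1.
rewrite wsumS qfactS -mulrA -gr big_distrr /=; apply: eq_bigr => c _.
rewrite mulrCA -IH -wsum_prod; congr (_ * _).
by apply: eq_wsum => w _; rewrite mulrC.
Qed.

(** The product over the letters is a change of weights, so its effect is a difference of elementary
    symmetric functions; the letter [c] picked out by [exch] becomes the first letter of the
    word. *)
Lemma wsum_clique N t g x a k : graded N t g -> exch N g -> (a < N)%N ->
  wsum N x k (fun w => pairw g w * \prod_(c <- w) g a c) =
  wsum N x k (fun w => pairw g w * (1 + qnum t k * (g a (head 0%N w) - 1))).
Proof.
case: k => [|k] gr ex ltaN; first by rewrite !wsum_nil big_nil qnum0 mul0r addr0.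
under [RHS]eq_wsum => w _ do rewrite mulrDr mulr1.
rewrite wsumD wsum_prod !(wsum_pairw _ _ gr).
suff -> : wsum N x k.+1 (fun w => pairw g w * (qnum t k.+1 * (g a (head 0%N w) - 1)))
   = qfact t k.+1 * (elsym N (fun c => x c * g a c) k.+1 - elsym N x k.+1) by ring.
rewrite ex // big_distrr wsumS; apply: eq_bigr => c _ /=.
rewrite wsumZr; under eq_wsum => w _ do rewrite mulrC.
by rewrite wsum_prod (wsum_pairw _ _ gr) qfactS; ring.
Qed.

(** With the letters after position [j] held fixed, their interaction with the prefix goes into the
    weights, and the prefix is a clique of its own. Since [0 < j], its first letter is that of the
    whole word. *)
Lemma wsum_clique_prefix N t g x a j k (H : seq nat -> R) :
    graded N t g -> exch N g -> (a < N)%N -> (0 < j)%N ->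
  wsum N x (j + k) (fun w => pairw g w * (\prod_(c <- take j w) g a c) * H (drop j w)) =
  wsum N x (j + k) (fun w => pairw g w * (1 + qnum t j * (g a (head 0%N w) - 1))
                             * H (drop j w)).
Proof.
move=> gr ex ltaN j0; rewrite !wsum_cat wsum_swap [RHS]wsum_swap.
apply: eq_wsum => w _.
have E (K : seq nat -> R) :
  wsum N x j (fun u => pairw g (u ++ w) * K u * H w) =
  wsum N (fun c => x c * \prod_(d <- w) g c d) j (fun u => pairw g u * K u) * (pairw g w * H w).
  by rewrite -wsum_prod -wsumZr; apply: eq_wsum => u _; rewrite pairw_cat; ring.
have := wsum_clique (fun c => x c * \prod_(d <- w) g c d) j gr ex ltaN.
move/(congr1 (fun z => z * (pairw g w * H w))); rewrite -!E => EE.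
transitivity (wsum N x j (fun u => pairw g (u ++ w) * \prod_(c <- u) g a c * H w)).
  by apply: eq_wsum => u su; rewrite take_size_cat ?drop_size_cat.
rewrite EE; apply: eq_wsum => u su; rewrite drop_size_cat //.
by case: u su => [|? ?] /=; [lia|].
Qed.

(** Reversal turns a suffix into a prefix and transposes [g]; hence the hypotheses on the transposed
    weight. *)
Lemma wsum_clique_suffix N t g x b j k (H : seq nat -> R) :
    graded N t (fun c d => g d c) -> exch N (fun c d => g d c) -> (b < N)%N -> (0 < k)%N ->
  wsum N x (j + k) (fun w => pairw g w * (\prod_(c <- drop j w) g c b) * H (take j w)) =
  wsum N x (j + k) (fun w => pairw g w * (1 + qnum t k * (g (last 0%N w) b - 1))
                             * H (take j w)).
Proof.
move=> gr ex ltbN k0.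
have := wsum_clique_prefix x (a := b) j (fun u => H (rev u)) gr ex ltbN k0.
rewrite [(k + j)%N]addnC wsum_rev [RHS]wsum_rev => E.
transitivity (wsum N x (j + k) (fun w => pairw (fun c d => g d c) (rev w) *
    (\prod_(c <- take k (rev w)) g c b) * H (rev (drop k (rev w))))).
  apply: eq_wsum => w sw; rewrite pairw_rev; congr (_ * _ * _).
    by rewrite take_rev sw addnK; apply: perm_big; rewrite perm_sym perm_rev.
  by rewrite drop_rev revK sw addnK.
rewrite E; apply: eq_wsum => w sw; rewrite pairw_rev drop_rev revK sw addnK.
congr (_ * (1 + _ * (g _ _ - 1)) * _).
by case/lastP: w sw => [|w d] sw; [move: sw => /=; lia | rewrite rev_rcons last_rcons].
Qed.

End Clique.
Arguments qnum : simpl never.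
Arguments qfact : simpl never.

(** * The ascent weight *)

Section Ascents.
Context {R : comNzRingType} (t : R).

(** The factor of an edge. The value 0 on equal colours kills improper colourings, so one product
    over the edges encodes both properness and the ascents. *)
Definition ascw (c d : nat) : R :=
  if (c < d)%N then t else if c == d then 0 else 1.

Lemma ascwxx c : ascw c c = 0. Proof. by rewrite /ascw ltnn eqxx. Qed.
Lemma ascw_lt c d : (c < d)%N -> ascw c d = t. Proof. by rewrite /ascw => ->. Qed.
Lemma ascw_gt c d : (d < c)%N -> ascw c d = 1.
Proof. by rewrite /ascw => ltdc; rewrite ltnNge ltnW //= gtn_eqF. Qed.

Lemma elsym_ascw_max N (x : nat -> R) k :
  elsym N (fun d => x d * ascw N d) k = elsym N x k.
Proof. by apply: eq_elsym => c ltcN; rewrite ascw_gt // mulr1. Qed.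

Lemma elsym_ascw_tr_max N (x : nat -> R) k :
  elsym N (fun d => x d * ascw d N) k = t ^+ k * elsym N x k.
Proof. by rewrite -elsymZ; apply: eq_elsym => c ltcN; rewrite ascw_lt // mulrC. Qed.

Lemma ascw_graded N : graded N t ascw.
Proof.
elim: N => [|N IH] x k; first by rewrite big_nil elsym_nil mulr0.
rewrite big_nat_recr //=.
(* The new largest colour [N] is an ascent from every [c], hence the factor t; it uses up one of the
   [k] letters, so the extra term is absent for [k = 0]. *)
have E : \sum_(0 <= c < N) x c * elsym N.+1 (fun d => x d * ascw c d) k =
  \sum_(0 <= c < N) x c * elsym N (fun d => x d * ascw c d) k +
  t * x N * (if k is k'.+1 then \sum_(0 <= c < N) x c * elsym N (fun d => x d * ascw c d) k' else 0).
  case: k => [|k]; first by rewrite mulr0 addr0; apply: eq_bigr => c _; rewrite !elsym0.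
  rewrite big_distrr -big_split /= big_nat [RHS]big_nat.
  by apply: eq_bigr => c /andP[_ ltcN]; rewrite ?elsymS (ascw_lt ltcN); ring.
rewrite E IH; case: k {E} => [|k].
  by rewrite !elsymS !elsym0 qnumS qnum0 expr0; ring.
by rewrite IH !elsymS !elsym_ascw_max ascwxx [qnum t k.+2]qnumSl; ring.
Qed.

Lemma ascw_tr_graded N : graded N t (fun c d => ascw d c).
Proof.
elim: N => [|N IH] x k; first by rewrite big_nil elsym_nil mulr0.
rewrite big_nat_recr //=.
have E : \sum_(0 <= c < N) x c * elsym N.+1 (fun d => x d * ascw d c) k =
  \sum_(0 <= c < N) x c * elsym N (fun d => x d * ascw d c) k +
  x N * (if k is k'.+1 then \sum_(0 <= c < N) x c * elsym N (fun d => x d * ascw d c) k' else 0).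
  case: k => [|k]; first by rewrite mulr0 addr0; apply: eq_bigr => c _; rewrite !elsym0.
  rewrite big_distrr -big_split /= big_nat [RHS]big_nat.
  by apply: eq_bigr => c /andP[_ ltcN]; rewrite ?elsymS (ascw_gt ltcN); ring.
rewrite E IH; case: k {E} => [|k].
  by rewrite !elsymS !elsym0 qnumS qnum0 expr0; ring.
by rewrite IH !elsymS !elsym_ascw_tr_max ascwxx [qnum t k.+2]qnumS; ring.
Qed.

(** On a set S of [k.+1] colours, j of them above [a]: if [a] is not in S, the left side is t^j - 1
    and the right side (t - 1)(1 + ... + t^(j-1)); if [a] is in S, the left side is -1 and the term
    [c = a] adds - t^j on the right. The proof reaches this by removing the largest colour. *)
Lemma ascw_exch N : exch N ascw.
Proof.
elim: N => [|N IH] x a k ltaN //; rewrite big_nat_recr //=.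
have [-> | ltaN'] : (a = N \/ (a < N)%N) by lia.
  rewrite big_nat big1 => [|c /andP[_ ltcN]]; last by rewrite (ascw_gt ltcN) subrr mulr0 mul0r.
  rewrite ascwxx; case: k => [|k]; first by rewrite !elsymS !elsym0 elsym_ascw_max ascwxx; ring.
  by rewrite !elsymS !elsym_ascw_max ascwxx; ring.
have E : \sum_(0 <= c < N) x c * (ascw a c - 1) * elsym N.+1 (fun d => x d * ascw c d) k =
  \sum_(0 <= c < N) x c * (ascw a c - 1) * elsym N (fun d => x d * ascw c d) k +
  t * x N * (if k is k'.+1 then \sum_(0 <= c < N) x c * (ascw a c - 1) *
                              elsym N (fun d => x d * ascw c d) k' else 0).
  case: k => [|k]; first by rewrite mulr0 addr0; apply: eq_bigr => c _; rewrite !elsym0.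
  rewrite big_distrr -big_split /= big_nat [RHS]big_nat.
  by apply: eq_bigr => c /andP[_ ltcN]; rewrite ?elsymS (ascw_lt ltcN); ring.
rewrite E -IH //; case: k {E} => [|k].
  by rewrite !elsymS !elsym0 ?elsym_ascw_max ?elsym_ascw_tr_max (ascw_lt ltaN'); ring.
by rewrite -IH // !elsymS !elsym_ascw_max ascwxx (ascw_lt ltaN'); ring.
Qed.

Lemma ascw_tr_exch N : exch N (fun c d => ascw d c).
Proof.
elim: N => [|N IH] x a k ltaN //; rewrite big_nat_recr //=.
have E (f : nat -> R) : \sum_(0 <= c < N) x c * f c * elsym N.+1 (fun d => x d * ascw d c) k =
  \sum_(0 <= c < N) x c * f c * elsym N (fun d => x d * ascw d c) k +
  x N * (if k is k'.+1 then \sum_(0 <= c < N) x c * f c *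
                              elsym N (fun d => x d * ascw d c) k' else 0).
  case: k => [|k]; first by rewrite mulr0 addr0; apply: eq_bigr => c _; rewrite !elsym0.
  rewrite big_distrr -big_split /= big_nat [RHS]big_nat.
  by apply: eq_bigr => c /andP[_ ltcN]; rewrite ?elsymS (ascw_gt ltcN); ring.
have [-> | ltaN'] : (a = N \/ (a < N)%N) by lia.
  (* For [a = N] all smaller colours carry the same factor t - 1, so the sum is an instance of
     [ascw_tr_graded]. *)
  have E' j : \sum_(0 <= c < N) x c * (ascw c N - 1) * elsym N (fun d => x d * ascw d c) j =
     (t - 1) * (qnum t j.+1 * elsym N x j.+1).
    rewrite -ascw_tr_graded big_distrr /= big_nat [RHS]big_nat.
    by apply: eq_bigr => c /andP[_ ltcN]; rewrite ?elsymS (ascw_lt ltcN); ring.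
  rewrite E E' ascwxx; case: k {E} => [|k].
    by rewrite !elsymS !elsym0 ?elsym_ascw_tr_max ascwxx (expr_qnum t 1); ring.
  by rewrite E' !elsymS !elsym_ascw_tr_max ascwxx !(expr_qnum t k.+2) (expr_qnum t k.+1); ring.
rewrite E -IH //; case: k {E} => [|k].
  by rewrite !elsymS !elsym0 ?elsym_ascw_max ?elsym_ascw_tr_max (ascw_gt ltaN'); ring.
by rewrite -IH // !elsymS !elsym_ascw_tr_max (ascw_gt ltaN'); ring.
Qed.

End Ascents.

(** * The chromatic sum as a combination of elementary symmetric functions *)

Section ChromaticSum.
Context {R : idomainType} (t : R) (N : nat) (x : nat -> R).
Hypothesis qnum_neq0 : forall k, qnum t k.+1 != 0.
Local Notation g := (ascw t).
Local Notation ws := (wsum N x).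
Local Notation e := (elsym N x).
Local Notation "[ k ]q" := (qnum t k) (at level 0, format "[ k ]q").
Local Notation "k `!q" := (qfact t k) (at level 2, format "k `!q").

Let asc_words k : ws k (pairw g) = k`!q * e k.
Proof. exact/wsum_pairw/ascw_graded. Qed.

Lemma elsym1E : e 1 = \sum_(0 <= a < N) x a.
Proof.
have := asc_words 1; rewrite wsumS qfactS qfact0 qnumS qnum0 expr0 add0r !mul1r => <-.
by apply: eq_bigr => a _; rewrite wsum_nil /= big_nil !mulr1.
Qed.

Lemma elsym2E : \sum_(0 <= b < N) x b * (\sum_(0 <= d < N) x d * (g d b - 1)) =
  (1 + t) * e 2 - e 1 ^+ 2.
Proof.
have -> : (1 + t) * e 2 = \sum_(0 <= b < N) x b * \sum_(0 <= d < N) x d * g d b.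
  have := asc_words 2; rewrite wsum_rcons !qfactS qfact0 !qnumS qnum0 expr0 expr1.
  rewrite add0r !mul1r => <- /=; apply: eq_bigr => b _; congr (_ * _).
  by rewrite wsumS; apply: eq_bigr => d _; rewrite wsum_nil /= !big_cons !big_nil !mulr1.
rewrite expr2 {1}elsym1E mulr_suml -sumrB /=; apply: eq_bigr => b _.
rewrite -mulrBr elsym1E -sumrB; congr (_ * _).
by apply: eq_bigr => d _; ring.
Qed.

Let suffix_all b k : (b < N)%N -> (0 < k)%N ->
  ws k (fun w => pairw g w * \prod_(c <- w) g c b) =
  k`!q * e k + [k]q * ws k (fun w => pairw g w * (g (last 0%N w) b - 1)).
Proof.
move=> ltbN k0.
have := wsum_clique_suffix x 0 (fun=> 1) (@ascw_tr_graded _ t N) (@ascw_tr_exch _ t N) ltbN k0.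
rewrite add0n => E.
transitivity (ws k (fun w => pairw g w * (\prod_(c <- drop 0 w) g c b) * 1)).
  by apply: eq_wsum => w _; rewrite drop0 mulr1.
rewrite E -asc_words -wsumZ -wsumD; apply: eq_wsum => w _; ring.
Qed.

Let prefix_all a k : (a < N)%N -> (0 < k)%N ->
  ws k (fun w => pairw g w * \prod_(c <- w) g a c) =
  k`!q * e k + [k]q * ws k (fun w => pairw g w * (g a (head 0%N w) - 1)).
Proof.
move=> ltaN k0; rewrite (wsum_clique _ _ (@ascw_graded _ t N) (@ascw_exch _ t N) ltaN).
rewrite -asc_words -wsumZ -wsumD; apply: eq_wsum => w _; ring.
Qed.

(** A letter [b] joined to a whole clique word of length [k] makes it a clique word of length
    [k.+1]; symmetrising [b] against the same word produces the end term. Comparing the two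
    evaluations isolates it. *)
Lemma sum_last_ascent k : (0 < k)%N ->
  [k]q * (\sum_(0 <= b < N) x b * ws k (fun w => pairw g w * (g (last 0%N w) b - 1))) =
  k.+1`!q * e k.+1 - k`!q * (e 1 * e k).
Proof.
move=> k0; rewrite mulrCA -!asc_words wsum_rcons elsym1E mulr_suml mulr_sumr -sumrB /=.
apply: eq_big_nat => b ltbN.
rewrite mulrCA -[[k]q * _](addKr (k`!q * e k)) -suffix_all // asc_words.
have -> : ws k (fun w => pairw g (rcons w b)) = ws k (fun w => pairw g w * \prod_(c <- w) g c b).
  by apply: eq_wsum => w _; rewrite pairw_rcons.
by ring.
Qed.

Lemma sum_head_ascent k : (0 < k)%N ->
  [k]q * (\sum_(0 <= a < N) x a * ws k (fun w => pairw g w * (g a (head 0%N w) - 1))) =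
  k.+1`!q * e k.+1 - k`!q * (e 1 * e k).
Proof.
move=> k0; rewrite mulrCA -!asc_words wsumS elsym1E mulr_suml mulr_sumr -sumrB /=.
apply: eq_big_nat => a ltaN.
rewrite mulrCA -[[k]q * _](addKr (k`!q * e k)) -prefix_all // asc_words.
have -> : ws k (fun w => pairw g (a :: w)) =
          ws k (fun w => pairw g w * \prod_(c <- w) g a c).
  by apply: eq_wsum => w _; rewrite /= mulrC.
by ring.
Qed.

(* Both end factors: symmetrising all letters but the last turns the letter [a]
   into the first letter of a longer clique word, whose last letter [d] is then
   symmetrised against the remaining ones. *)
Lemma sum_both_ascents j (k := j.+2) :
  [k]q * ([k.-1]q * \sum_(0 <= b < N) x b * \sum_(0 <= a < N) x a *
    ws k (fun w => pairw g w * (g a (head 0%N w) - 1) * (g (last 0%N w) b - 1))) =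
  k`!q * (t ^+ k.-1 * ((1 + t) * e 2 - e 1 ^+ 2) * e k
     + [k.-1]q * ([k.+2]q * e k.+2 - e 1 * e k.+1)
     - e 1 * ([k.+1]q * e k.+1 - e 1 * e k)).
Proof.
pose l i b := ws i (fun w => pairw g w * (g (last 0%N w) b - 1)).
pose z b := \sum_(0 <= d < N) x d * (g d b - 1).
have step1 a b : (a < N)%N ->
    [k.-1]q * ws k (fun w => pairw g w * (g a (head 0%N w) - 1) * (g (last 0%N w) b - 1)) =
    ws k (fun w => pairw g w * (\prod_(c <- take j.+1 w) g a c) * (g (last 0%N w) b - 1)) - l k b.
  move=> ltaN.
  have := wsum_clique_prefix x 1 (fun u => g (last 0%N u) b - 1) (@ascw_graded _ t N)
    (@ascw_exch _ t N) ltaN (ltn0Sn j).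
  have lastE w : size w = k -> last 0%N (drop j.+1 w) = last 0%N w.
    by move=> sw; rewrite -{2}(cat_take_drop j.+1 w) last_cat; case: (drop _ _) (size_drop j.+1 w) => //=; rewrite sw; lia.
  rewrite addn1 -/k => E.
  have -> : ws k (fun w => pairw g w * (\prod_(c <- take j.+1 w) g a c) * (g (last 0%N w) b - 1))
    = ws k (fun w => pairw g w * (\prod_(c <- take j.+1 w) g a c) * (g (last 0%N (drop j.+1 w)) b - 1)).
    by apply: eq_wsum => w sw; rewrite lastE.
  by rewrite E /l -wsumZ -wsumB; apply: eq_wsum => w sw; rewrite lastE //; ring.
have step2 b :
    \sum_(0 <= a < N) x a *
      ws k (fun w => pairw g w * (\prod_(c <- take j.+1 w) g a c) * (g (last 0%N w) b - 1)) =
    \sum_(0 <= d < N) x d * (g d b - 1) *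
      ws k (fun w => pairw g w * \prod_(c <- drop 1 w) g c d).
  under eq_bigr do rewrite wsum_rcons mulr_sumr.
  rewrite exchange_big; apply: eq_bigr => d _; rewrite wsumS mulr_sumr.
  apply: eq_bigr => a _; rewrite -!mulrA mulrCA; congr (_ * _).
  rewrite [RHS]mulrCA; congr (_ * _); rewrite -wsumZ.
  apply: eq_wsum => w sw.
  by rewrite -cats1 take_size_cat // cats1 last_rcons pairw_rcons /= drop0; ring.
(* Joining [d] to all letters brings the end term [l k d] with factor [k], joining it to all but the
   first with factor [k-1]. Eliminating [l k d] leaves the coefficient [k] - [k-1] = t^(k-1). *)
have step3 d : (d < N)%N ->
    [k]q * ws k (fun w => pairw g w * \prod_(c <- drop 1 w) g c d) =
    t ^+ k.-1 * (k`!q * e k) +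
    [k.-1]q * ws k (fun w => pairw g w * \prod_(c <- w) g c d).
  move=> ltdN; rewrite suffix_all //.
  have := wsum_clique_suffix x 1 (fun=> 1) (@ascw_tr_graded _ t N) (@ascw_tr_exch _ t N) ltdN (ltn0Sn j).
  rewrite add1n -/k => E.
  have -> : ws k (fun w => pairw g w * \prod_(c <- drop 1 w) g c d) =
            ws k (fun w => pairw g w * (\prod_(c <- drop 1 w) g c d) * 1).
    by apply: eq_wsum => w _; rewrite mulr1.
  have -> : t ^+ k.-1 = [k]q - [k.-1]q by rewrite [[k]q]qnumS addrC addKr.
  rewrite E (_ : ws k _ = k`!q * e k + [k.-1]q * l k d); first by rewrite /l; ring.
  rewrite -asc_words /l -wsumZ -wsumD; apply: eq_wsum => w _; ring.
have step5 b : \sum_(0 <= d < N) x d * (g d b - 1) *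
      ws k (fun w => pairw g w * \prod_(c <- w) g c d) = l k.+1 b.
  rewrite /l wsum_rcons; apply: eq_bigr => d _.
  rewrite -mulrA; congr (_ * _); rewrite -wsumZ; apply: eq_wsum => w _.
  by rewrite last_rcons pairw_rcons; ring.
have main b : [k]q * ([k.-1]q * \sum_(0 <= a < N) x a *
    ws k (fun w => pairw g w * (g a (head 0%N w) - 1) * (g (last 0%N w) b - 1))) =
    z b * (t ^+ k.-1 * (k`!q * e k)) + [k.-1]q * l k.+1 b - [k]q * (e 1 * l k b).
  have -> : [k.-1]q * \sum_(0 <= a < N) x a *
       ws k (fun w => pairw g w * (g a (head 0%N w) - 1) * (g (last 0%N w) b - 1)) =
     \sum_(0 <= d < N) x d * (g d b - 1) *
       ws k (fun w => pairw g w * \prod_(c <- drop 1 w) g c d) - e 1 * l k b.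
    rewrite -step2 elsym1E mulr_suml mulr_sumr -sumrB /=.
    by apply: eq_big_nat => a ltaN; rewrite mulrCA step1 // mulrBr.
  rewrite mulrBr; congr (_ - _); rewrite -step5 /z mulr_suml !mulr_sumr -big_split /=.
  apply: eq_big_nat => d ltdN; rewrite mulrCA step3 //; ring.
transitivity (\sum_(0 <= b < N) x b * (z b * (t ^+ k.-1 * (k`!q * e k))
   + [k.-1]q * l k.+1 b - [k]q * (e 1 * l k b))).
  rewrite !mulr_sumr /=; apply: eq_bigr => b _; rewrite -main; ring.
transitivity ((\sum_(0 <= b < N) x b * z b) * (t ^+ k.-1 * (k`!q * e k))
  + [k.-1]q * (\sum_(0 <= b < N) x b * l k.+1 b)
  - e 1 * ([k]q * \sum_(0 <= b < N) x b * l k b)).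
  rewrite !mulr_sumr mulr_suml -big_split -sumrB /=.
  by apply: eq_bigr => b _; ring.
rewrite elsym2E sum_last_ascent //.
suff -> : \sum_(0 <= b < N) x b * l k.+1 b = k`!q * ([k.+2]q * e k.+2 - e 1 * e k.+1).
  by rewrite [k.+1`!q]qfactS; ring.
(* [sum_last_ascent] at [k.+1] carries the factor [k+1], cancelled here. *)
apply: (mulfI (qnum_neq0 k)); rewrite sum_last_ascent // !qfactS; ring.
Qed.

(** The segments joined to [a] and to [b] are disjoint, so each can be symmetrised while the other
    is a spectator; the four products of end factors are then summed by the preceding lemmas. *)
Lemma chromatic_words p v q (k := (p + v + q)%N) :
    (0 < p)%N -> (0 < v)%N -> (0 < q)%N ->
  [k]q * ([k.-1]q * (\sum_(0 <= b < N) x b * \sum_(0 <= a < N) x a *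
     ws k (fun w => pairw g w * (\prod_(c <- take p w) g a c)
                    * \prod_(c <- drop (p + v) w) g c b))) =
  k`!q * ([k]q * [k.-1]q * e 1 ^+ 2 * e k
    + ([p]q + [q]q) * [k.-1]q * e 1 * ([k.+1]q * e k.+1 - e 1 * e k)
    + [p]q * [q]q * (t ^+ k.-1 * ((1 + t) * e 2 - e 1 ^+ 2) * e k
       + [k.-1]q * ([k.+2]q * e k.+2 - e 1 * e k.+1)
       - e 1 * ([k.+1]q * e k.+1 - e 1 * e k))).
Proof.
move=> p0 v0 q0.
pose H a b := ws k (fun w => pairw g w * (g a (head 0%N w) - 1) * (g (last 0%N w) b - 1)).
pose h a := ws k (fun w => pairw g w * (g a (head 0%N w) - 1)).
pose l b := ws k (fun w => pairw g w * (g (last 0%N w) b - 1)).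
have step a b : (a < N)%N -> (b < N)%N ->
    ws k (fun w => pairw g w * (\prod_(c <- take p w) g a c) * \prod_(c <- drop (p + v) w) g c b)
    = k`!q * e k + [p]q * h a + [q]q * l b + [p]q * [q]q * H a b.
  move=> ltaN ltbN.
  have E1 := wsum_clique_prefix x (v + q) (fun u => \prod_(c <- drop v u) g c b)
    (@ascw_graded _ t N) (@ascw_exch _ t N) ltaN p0.
  have E2 := wsum_clique_suffix x (p + v) (fun u => 1 + [p]q * (g a (head 0%N u) - 1))
    (@ascw_tr_graded _ t N) (@ascw_tr_exch _ t N) ltbN q0.
  rewrite addnA -/k in E1; rewrite -/k in E2.
  transitivity (ws k (fun w => pairw g w * (\prod_(c <- take p w) g a c)
                              * \prod_(c <- drop v (drop p w)) g c b)).
    by apply: eq_wsum => w _; rewrite drop_drop [(v + p)%N]addnC.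
  have headE w : size w = k -> head 0%N (take (p + v) w) = head 0%N w.
    by case: w => // c w _; rewrite -[(p + v)%N]prednK //; lia.
  rewrite E1; transitivity (ws k (fun w => pairw g w * (\prod_(c <- drop (p + v) w) g c b)
       * (1 + [p]q * (g a (head 0%N (take (p + v) w)) - 1)))).
    by apply: eq_wsum => w sw; rewrite headE // drop_drop [(v + p)%N]addnC; ring.
  rewrite E2 -asc_words /h /l /H -!wsumZ -!wsumD.
  by apply: eq_wsum => w sw; rewrite headE //; ring.
transitivity ([k]q * ([k.-1]q * (e 1 * e 1 * (k`!q * e k)
   + [p]q * e 1 * (\sum_(0 <= a < N) x a * h a)
   + [q]q * e 1 * (\sum_(0 <= b < N) x b * l b)
   + [p]q * [q]q * \sum_(0 <= b < N) x b * \sum_(0 <= a < N) x a * H a b))).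
  congr (_ * (_ * _)).
  transitivity (\sum_(0 <= b < N) x b * (e 1 * (k`!q * e k)
     + [p]q * (\sum_(0 <= a < N) x a * h a) + [q]q * (e 1 * l b)
     + [p]q * [q]q * \sum_(0 <= a < N) x a * H a b)).
    apply: eq_big_nat => b ltbN; congr (_ * _).
    rewrite elsym1E !mulr_suml !mulr_sumr -!big_split /=.
    by apply: eq_big_nat => a ltaN; rewrite step //; ring.
  transitivity ((\sum_(0 <= b < N) x b) * (e 1 * (k`!q * e k) + [p]q * \sum_(0 <= a < N) x a * h a)
     + ([q]q * e 1) * (\sum_(0 <= b < N) x b * l b)
     + [p]q * [q]q * \sum_(0 <= b < N) x b * \sum_(0 <= a < N) x a * H a b); last first.
    by rewrite -elsym1E; ring.
  rewrite mulr_suml [([q]q * _) * _]mulr_sumr [([p]q * [q]q) * _]mulr_sumr -!big_split /=.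
  by apply: eq_bigr => b _; ring.
have k2 : k = k.-2.+2 by rewrite /k; lia.
have eH := sum_both_ascents k.-2; rewrite -k2 in eH.
have k0 : (0 < k)%N by rewrite k2.
transitivity (k`!q * ([k]q * [k.-1]q * e 1 ^+ 2 * e k)
   + [k.-1]q * [p]q * e 1 * ([k]q * \sum_(0 <= a < N) x a * h a)
   + [k.-1]q * [q]q * e 1 * ([k]q * \sum_(0 <= b < N) x b * l b)
   + [p]q * [q]q * ([k]q * ([k.-1]q * \sum_(0 <= b < N) x b * \sum_(0 <= a < N) x a * H a b))).
  by ring.
by rewrite eH sum_head_ascent // sum_last_ascent // !qfactS; ring.
Qed.

End ChromaticSum.

(** * Sums over colourings as sums over words *)

Lemma sum_tuple_words (R : comNzRingType) N (x : nat -> R) n (F : seq nat -> R) :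
  \sum_(h : n.-tuple 'I_N) (\prod_(c <- h) x (val c)) * F [seq val c | c <- h] = wsum N x n F.
Proof.
elim: n F => [|n IH] F.
  rewrite wsum_nil (big_pred1 [tuple]) ?big_nil ?mul1r //.
  by move=> h; rewrite [h]tuple0 /= eqxx.
rewrite wsumS big_mkord.
rewrite (reindex (fun ch : 'I_N * n.-tuple 'I_N => [tuple of ch.1 :: ch.2])) /=; last first.
  exists (fun h : n.+1.-tuple 'I_N => (thead h, [tuple of behead h])) => [[c h] _|h _] /=.
    by congr (_, _); apply: val_inj.
  by rewrite [RHS]tuple_eta; apply: val_inj.
rewrite -(pair_bigA _ (fun c (h : n.-tuple 'I_N) =>
  (\prod_(d <- c :: h) x (val d)) * F (val c :: [seq val d | d <- h]))) /=.
apply: eq_bigr => c _; rewrite -IH big_distrr /=.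
by apply: eq_bigr => h _; rewrite big_cons mulrA.
Qed.

Lemma sum_ffun_words (R : comNzRingType) N (x : nat -> R) n (F : seq nat -> R) :
  \sum_(k : {ffun 'I_n -> 'I_N}) (\prod_v x (val (k v))) * F [seq val (k i) | i <- enum 'I_n]
  = wsum N x n F.
Proof.
rewrite -sum_tuple_words.
rewrite (reindex (fun h : n.-tuple 'I_N => [ffun i => tnth h i])) /=; last first.
  exists (fun k : {ffun 'I_n -> 'I_N} => [tuple k i | i < n]) => [h _|k _].
    by apply: eq_from_tnth => i; rewrite tnth_mktuple ffunE.
  by apply/ffunP => i; rewrite ffunE tnth_mktuple.
apply: eq_bigr => h _; congr (_ * F _).
  by rewrite [RHS]big_tuple; apply: eq_bigr => i _; rewrite ffunE.
rewrite -[in RHS](map_tnth_enum h) -map_comp.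
by apply: eq_map => i; rewrite /= ffunE.
Qed.

(** Indexed by natural numbers to serve as the weights of [wsum]; the default 0 is never reached by
    colours below [N]. *)
Definition mvar N (c : nat) : {mpoly {poly int}[N]} :=
  if insub c is Some i then 'X_(i : 'I_N) else 0.

Lemma mvarE N (i : 'I_N) : mvar N (val i) = 'X_i.
Proof. by rewrite /mvar valK. Qed.

Definition tvar N : {mpoly {poly int}[N]} := ('X : {poly int})%:MP.

Lemma colouring_weight n N m (k : {ffun 'I_n -> 'I_N}) :
  (if proper_col n N m k then tvar N ^+ asc n N m k else 0) =
  \prod_(u < n) \prod_(v < n)
    (if incedge m u.+1 v.+1 then ascw (tvar N) (k u) (k v) else 1).
Proof.
rewrite pair_bigA /=; case: ifPn => [/forallP prop | ].
  rewrite /asc -prodr_const big_mkcond /=; apply: eq_bigr => -[u v] _ /=.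
  rewrite inE /=; case e: (incedge _ _ _) => //=.
  have /forallP/(_ v) := prop u; rewrite e /ascw /= => ne.
  by case: ifP => // _; rewrite -val_eqE in ne; rewrite (negbTE ne).
case/forallPn => u /forallPn[v]; rewrite negb_imply negbK => /andP[e /eqP kuv].
by rewrite (bigD1 (u, v)) //= e kuv ascwxx mul0r.
Qed.

Lemma prod_take (R : comNzRingType) (f : nat -> R) w p :
  \prod_(0 <= j < size w) (if (j < p)%N then f (nth 0%N w j) else 1) = \prod_(c <- take p w) f c.
Proof.
elim: w p => [|c w IH] [|p]; rewrite ?big_nil //; first by rewrite big1.
by rewrite big_nat_recl //= big_cons -IH.
Qed.

Lemma prod_drop (R : comNzRingType) (f : nat -> R) w p :
  \prod_(0 <= j < size w) (if (p <= j)%N then f (nth 0%N w j) else 1) = \prod_(c <- drop p w) f c.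
Proof.
elim: w p => [|c w IH] [|p]; rewrite ?big_nil //; first by rewrite -(big_nth 0%N predT).
by rewrite big_nat_recl //= mul1r -IH.
Qed.

Lemma pairw_nth (R : comNzRingType) (g : nat -> nat -> R) w :
  \prod_(0 <= i < size w) \prod_(0 <= j < size w)
     (if (i < j)%N then g (nth 0%N w i) (nth 0%N w j) else 1) = pairw g w.
Proof.
elim: w => [|c w IH]; first by rewrite big_nil.
rewrite /= big_nat_recl //= big_nat_recl //= mul1r -(big_nth 0%N predT (g c)).
rewrite -IH; congr (_ * _); apply: eq_bigr => i _.
by rewrite big_nat_recl //= mul1r.
Qed.

(** A colouring is read as the word [a], [w], [b]. The edges at vertex 1 give the product over the
    first [p] letters, those at [n] the product over the last [q], and the middle ones [pairw]. *)
Lemma chromQ_words n N m p v q :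
    n = (p + v + q).+2 ->
    (forall j, (j < p + v + q)%N -> incedge m 1 j.+2 = (j < p)%N) ->
    incedge m 1 n = false ->
    (forall i j, (i < p + v + q)%N -> (j < p + v + q)%N -> incedge m i.+2 j.+2 = (i < j)%N) ->
    (forall i, (i < p + v + q)%N -> incedge m i.+2 n = (p + v <= i)%N) ->
  chromQ n N m =
  \sum_(0 <= b < N) mvar N b * \sum_(0 <= a < N) mvar N a *
     wsum N (mvar N) (p + v + q) (fun w => pairw (ascw (tvar N)) w *
        (\prod_(c <- take p w) ascw (tvar N) a c) *
        \prod_(c <- drop (p + v) w) ascw (tvar N) c b).
Proof.
move=> En; set k := (p + v + q)%N in En * => E1 E1n Emid Eln.
pose F w : {mpoly {poly int}[N]} := \prod_(0 <= i < n) \prod_(0 <= j < n)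
  (if incedge m i.+1 j.+1 then ascw (tvar N) (nth 0%N w i) (nth 0%N w j) else 1).
transitivity (wsum N (mvar N) n F).
  rewrite -sum_ffun_words /chromQ big_mkcond; apply: eq_bigr => kap _ /=.
  transitivity ((\prod_v mvar N (val (kap v))) *
     (if proper_col n N m kap then tvar N ^+ asc n N m kap else 0)).
    case: ifP => _; last by rewrite mulr0.
    rewrite -mul_mpolyC rmorphXn mulrC; congr (_ * _).
    by apply: eq_bigr => v' _; rewrite mvarE.
  rewrite colouring_weight; congr (_ * _); rewrite /F big_mkord.
  apply: eq_bigr => u _; rewrite big_mkord; apply: eq_bigr => u' _.
  have E (i : 'I_n) : nth 0%N [seq val (kap i) | i <- enum 'I_n] i = kap i.
    by rewrite (nth_map i) ?size_enum_ord // nth_ord_enum.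
  by rewrite !E.
rewrite En wsumS.
under eq_bigr => a _ do rewrite wsum_rcons big_distrr /=.
rewrite exchange_big; apply: eq_bigr => b _; rewrite big_distrr /=.
apply: eq_bigr => a _; rewrite mulrCA; congr (_ * (_ * _)).
apply: eq_wsum => w sw; rewrite /F En.
have nthw j : (j < k)%N -> nth 0%N (rcons w b) j = nth 0%N w j by move=> ltjk; rewrite nth_rcons sw ltjk.
have nthb : nth 0%N (rcons w b) k = b by rewrite nth_rcons sw ltnn eqxx.
have row0 : \prod_(0 <= j < k.+2)
    (if incedge m 1 j.+1 then ascw (tvar N) a (nth 0%N (a :: rcons w b) j) else 1)
    = \prod_(c <- take p w) ascw (tvar N) a c.
  rewrite big_nat_recl // big_nat_recr //= -En E1n mul1r mulr1 -prod_take sw.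
  by apply: eq_big_nat => j ltjk; rewrite E1 ?nthw //; lia.
have rowi i : (i < k)%N -> \prod_(0 <= j < k.+2)
    (if incedge m i.+2 j.+1 then ascw (tvar N) (nth 0%N w i) (nth 0%N (a :: rcons w b) j) else 1)
    = (\prod_(0 <= j < k) (if (i < j)%N then ascw (tvar N) (nth 0%N w i) (nth 0%N w j) else 1))
      * (if (p + v <= i)%N then ascw (tvar N) (nth 0%N w i) b else 1).
  move=> ltik; rewrite big_nat_recl // big_nat_recr //= -En Eln // nthb mul1r; congr (_ * _).
  by apply: eq_big_nat => j ltjk; rewrite Emid ?nthw //; lia.
have rown : \prod_(0 <= j < k.+2)
    (if incedge m k.+2 j.+1 then ascw (tvar N) b (nth 0%N (a :: rcons w b) j) else 1) = 1.
  by rewrite big_nat big1 // => j ltj; case: ifP => //; rewrite /incedge; lia.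
rewrite big_nat_recl // [X in X * _ = _]row0 big_nat_recr //.
rewrite [X in _ * (_ * X) = _](_ : _ = 1); last by rewrite /= nthb.
rewrite mulr1 mulrAC mulrC; congr (_ * _).
rewrite -pairw_nth sw -prod_drop sw -big_split /=.
by apply: eq_big_nat => i /andP[_ ltik]; rewrite nthw // rowi.
Qed.

(** * Tableaux with a long first column *)

(** One predicate for both kinds of tableaux: semistandard ones take [leq] and [ltn]; P-tableaux
    take the order of P along rows and its negated converse down columns. *)
Definition tableau (rowr colr : rel nat) (T : seq (seq nat)) : bool :=
  all (fun row => sorted rowr row) T &&
  all (fun i => all (fun j => colr (nth 0%N (nth [::] T i) j) (nth 0%N (nth [::] T i.+1) j))
                    (iota 0 (size (nth [::] T i.+1))))
      (iota 0 (size T).-1).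

Lemma is_ssytE T : is_ssyt T = tableau leq ltn T.
Proof. by []. Qed.

Lemma tableau_cons2 rowr colr r1 r2 T :
  tableau rowr colr (r1 :: r2 :: T) =
  [&& sorted rowr r1,
      all (fun j => colr (nth 0%N r1 j) (nth 0%N r2 j)) (iota 0 (size r2))
    & tableau rowr colr (r2 :: T)].
Proof.
rewrite /tableau /= (iotaDl 1 0) all_map /=.
set A := sorted rowr r1; set B := all _ (iota 0 (size r2)).
by case: A; case: B; rewrite /= ?andbF ?andbT.
Qed.

Lemma tableau_hook rowr colr a r w :
  tableau rowr colr ((a :: r) :: [seq [:: c] | c <- w]) = path rowr a r && path colr a w.
Proof.
elim: w a r => [|c w IH] a r; first by rewrite /tableau /= !andbT.
by rewrite /= tableau_cons2 /= IH /= andbT.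
Qed.

Lemma reshape_ones (w : seq nat) n : size w = n -> reshape (nseq n 1%N) w = [seq [:: c] | c <- w].
Proof.
elim: n w => [|n IH] [|c w] //= [sw].
by rewrite drop0 take0 IH.
Qed.

Section SchurSums.
Context {R : comNzRingType} (N : nat) (x : nat -> R).
Local Notation ws := (wsum N x).
Local Notation e := (elsym N x).

Lemma wsum_restrict M k (F : seq nat -> R) : (M <= N)%N ->
  ws k (fun w => (all (fun c => (c < M)%N) w)%:R * F w) = wsum M x k F.
Proof.
move=> leMN; elim: k F => [|k IH] F; first by rewrite !wsum_nil mul1r.
rewrite !wsumS (big_cat_nat (n := M)) //= [X in _ + X]big_nat [X in _ + X]big1 ?addr0.
  apply: eq_big_nat => c ltcM; rewrite -IH; congr (_ * _).
  by apply: eq_wsum => w _; rewrite (_ : (c < M)%N = true) //; lia.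
move=> c lec; rewrite (_ : (c < M)%N = false) /=; last by lia.
by rewrite -[RHS](mulr0 (x c)) -(wsum0 N x k); congr (_ * _); apply: eq_wsum => w _; rewrite mul0r.
Qed.

End SchurSums.

(** The last letter of an increasing word is its maximum, and the others range over the smaller
    alphabet: this is the recursion of [elsym], unrolled. *)
Lemma elsym_sorted (R : comNzRingType) N (x : nat -> R) k :
  wsum N x k (fun w => (sorted ltn w)%:R) = elsym N x k.
Proof.
elim: k N => [|k IH] N; first by rewrite wsum_nil elsym0.
have -> : elsym N x k.+1 = \sum_(0 <= c < N) x c * elsym c x k.
  elim: N => [|N IHN]; first by rewrite big_nil elsym_nil.
  by rewrite elsymS big_nat_recr //= IHN.
rewrite wsum_rcons; apply: eq_big_nat => c ltcN; congr (_ * _).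
have lecN : (c <= N)%N by lia.
rewrite -IH -(wsum_restrict _ _ _ lecN).
apply: eq_wsum => w _; rewrite -natrM mulnb; congr (nat_of_bool _)%:R.
by rewrite !(sorted_pairwise ltn_trans) pairwise_rcons.
Qed.

(** * The four Schur functions in terms of elementary ones *)

Section SchurElem.
Context {R : comNzRingType} (N : nat) (x : nat -> R).
Local Notation ws := (wsum N x).
Local Notation e := (elsym N x).
(** The contribution of [j] column cells below an entry [a]. The long first column enters only
    through it, which leaves at most four explicit letters. *)
Let I j a := ws j (fun w => (path ltn a w)%:R).
Local Notation S F := (\sum_(0 <= a < N) x a * F a).

Let e_col j : e j.+1 = S (I j).
Proof. by rewrite -elsym_sorted wsumS. Qed.

Let I_S j b : I j.+1 b = \sum_(0 <= a < N) x a * ((b < a)%:R * I j a).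
Proof.
rewrite /I wsumS; apply: eq_bigr => a _; congr (_ * _); rewrite /I -wsumZ.
by apply: eq_wsum => w _; rewrite /= -natrM mulnb.
Qed.

Let e1 : e 1 = \sum_(0 <= a < N) x a.
Proof. by rewrite e_col; apply: eq_bigr => a _; rewrite /I wsum_nil mulr1. Qed.

Let leE a b : ((a <= b)%N)%:R = 1 - ((b < a)%N)%:R :> R.
Proof. by rewrite ltnNge; case: (a <= b)%N; rewrite /= ?subr0 ?subrr. Qed.

Definition schurw la := ws (sumn la) (fun w => (is_ssyt (reshape la w))%:R).

Lemma schurw_1 n : schurw (nseq n 1%N) = e n.
Proof.
rewrite /schurw sumn_nseq mul1n -elsym_sorted; apply: eq_wsum => w sw.
rewrite reshape_ones // is_ssytE; congr (nat_of_bool _)%:R.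
by case: w {sw} => [|a w] //=; rewrite tableau_hook.
Qed.

Let hook1 j : schurw (2 :: nseq j 1)%N =
  S (fun a => \sum_(0 <= b < N) x b * ((a <= b)%:R * I j a)).
Proof.
rewrite /schurw /= sumn_nseq mul1n !wsumS; apply: eq_bigr => a _; congr (_ * _).
rewrite wsumS; apply: eq_bigr => b _; congr (_ * _); rewrite /I -wsumZ.
apply: eq_wsum => w sw.
by rewrite /= take0 drop0 reshape_ones // is_ssytE tableau_hook /= andbT -natrM mulnb.
Qed.

(** Pieri rule for a column and one box: if [a <= b] fails, then [b] can be put on top of the
    column. *)
Lemma schurw_21 j : schurw (2 :: nseq j 1)%N = e j.+1 * e 1 - e j.+2.
Proof.
rewrite hook1 e1 !e_col mulr_suml.
under [X in _ - X]eq_bigr => b _ do rewrite I_S mulr_sumr.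
rewrite exchange_big -sumrB; apply: eq_bigr => a _.
rewrite !mulr_sumr -sumrB; apply: eq_bigr => b _.
rewrite leE; ring.
Qed.

(** A column with top [a] times h_2 = e_1^2 - e_2, the latter as rows [b <= c]: if [a <= b] this is
    the required hook; if [b < a], then [b] tops a longer column with [c] beside it. *)
Lemma schurw_31 j :
  schurw (3 :: nseq j 1)%N = e j.+1 * (e 1 ^+ 2 - e 2) - e j.+2 * e 1 + e j.+3.
Proof.
have h2 : e 1 ^+ 2 - e 2 = S (fun b => \sum_(0 <= c < N) x c * (b <= c)%:R).
  rewrite (e_col 1) expr2 !e1 mulr_suml.
  under [X in _ - X]eq_bigr => b _ do rewrite I_S mulr_sumr.
  rewrite exchange_big -sumrB; apply: eq_bigr => a _.
  rewrite !mulr_sumr -sumrB; apply: eq_bigr => b _.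
  by rewrite /I wsum_nil leE /=; ring.
have -> : e j.+1 * (e 1 ^+ 2 - e 2) - e j.+2 * e 1 + e j.+3 =
  e j.+1 * (e 1 ^+ 2 - e 2) - schurw (2 :: nseq j.+1 1)%N by rewrite schurw_21; ring.
rewrite h2 hook1 mulr_sumr -sumrB.
rewrite /schurw /= sumn_nseq mul1n wsumS.
transitivity (\sum_(0 <= a < N) \sum_(0 <= b < N) \sum_(0 <= c < N)
   x a * x b * x c * ((a <= b)%:R * (b <= c)%:R * I j a)).
  apply: eq_bigr => a _; rewrite wsumS mulr_sumr; apply: eq_bigr => b _.
  rewrite wsumS !mulr_sumr; apply: eq_bigr => c _; rewrite -!mulrA; congr (_ * (_ * (_ * _))).
  rewrite mulrA -natrM mulnb /I -wsumZ; apply: eq_wsum => w sw.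
  by rewrite /= take0 drop0 reshape_ones // is_ssytE tableau_hook /= andbT -natrM mulnb.
rewrite exchange_big; apply: eq_bigr => b _; rewrite exchange_big /=.
have colE : e j.+1 - I j.+1 b = S (fun a => (a <= b)%:R * I j a).
  by rewrite e_col I_S -sumrB; apply: eq_bigr => a _; rewrite leE; ring.
transitivity (x b * \sum_(0 <= c < N) x c * (b <= c)%:R * (e j.+1 - I j.+1 b)).
  rewrite colE mulr_sumr; apply: eq_bigr => c _; rewrite !mulr_sumr.
  by apply: eq_bigr => a _; ring.
rewrite !mulr_sumr -sumrB; apply: eq_bigr => c _; ring.
Qed.

Let S4 (f : nat -> nat -> nat -> nat -> R) := \sum_(0 <= a < N) \sum_(0 <= b < N)
  \sum_(0 <= c < N) \sum_(0 <= d < N) x a * x b * x c * x d * f a b c d.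

Let S4_12 f : S4 f = S4 (fun a b c d => f b a c d).
Proof.
rewrite /S4 exchange_big; do 4!apply: eq_bigr => ? _; ring.
Qed.

Let S4_23 f : S4 f = S4 (fun a b c d => f a c b d).
Proof.
rewrite /S4; apply: eq_bigr => a _; rewrite exchange_big.
do 3!apply: eq_bigr => ? _; ring.
Qed.

Let S4_34 f : S4 f = S4 (fun a b c d => f a b d c).
Proof.
rewrite /S4; do 2!apply: eq_bigr => ? _; rewrite exchange_big.
do 2!apply: eq_bigr => ? _; ring.
Qed.

Let S4D f g : S4 f + S4 g = S4 (fun a b c d => f a b c d + g a b c d).
Proof.
rewrite /S4 -big_split; apply: eq_bigr => a _ /=; rewrite -big_split; apply: eq_bigr => b _ /=.
rewrite -big_split; apply: eq_bigr => c _ /=; rewrite -big_split; apply: eq_bigr => d _ /=.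
by rewrite mulrDr.
Qed.

Let eq_S4 f g : (forall a b c d, f a b c d = g a b c d) -> S4 f = S4 g.
Proof. by move=> fg; rewrite /S4; do 4!apply: eq_bigr => ? _; rewrite fg. Qed.

(* In the product of the columns [a < c < ...] and [b < d], the non-tableaux with
   [b < a] and those with [a <= b] and [d < c] match the pairs of a column
   [b < a < c < ...] (resp. [b < d < c < ...]) with one extra letter [d > b]
   (resp. [a <= b]). *)
Lemma schurw_22 j : schurw (2 :: 2 :: nseq j 1)%N = e j.+2 * e 2 - e j.+3 * e 1.
Proof.
have E22 : schurw (2 :: 2 :: nseq j 1)%N =
    S4 (fun a b c d => [&& a <= b, c <= d, a < c & b < d]%N%:R * I j c).
  rewrite /schurw /= sumn_nseq mul1n wsumS; apply: eq_bigr => a _.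
  rewrite wsumS !mulr_sumr; apply: eq_bigr => b _.
  rewrite wsumS !mulr_sumr; apply: eq_bigr => c _.
  rewrite wsumS !mulr_sumr; apply: eq_bigr => d _.
  rewrite -!mulrA; congr (_ * (_ * (_ * (_ * _)))); rewrite /I -wsumZ.
  apply: eq_wsum => w sw; rewrite -natrM mulnb; congr (nat_of_bool _)%:R.
  rewrite /= take0 drop0 reshape_ones // is_ssytE tableau_cons2 tableau_hook /= !andbT.
  by case: (a <= b)%N; case: (c <= d)%N; case: (a < c)%N; case: (b < d)%N.
have Eprod : e j.+2 * e 2 = S4 (fun a b c d => (a < c)%:R * (b < d)%:R * I j c).
  rewrite S4_23 (e_col j.+1) (e_col 1) mulr_suml; apply: eq_bigr => a _.
  rewrite I_S -!mulrA mulr_suml !mulr_sumr; apply: eq_bigr => c _.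
  rewrite !mulr_sumr; apply: eq_bigr => b _; rewrite I_S !mulr_sumr.
  by apply: eq_bigr => d _; rewrite /I wsum_nil /=; ring.
have Ecol : e j.+3 * e 1 = S4 (fun a b c d => (a < b)%:R * (b < c)%:R * I j c).
  rewrite (e_col j.+2) e1 mulr_suml; apply: eq_bigr => a _.
  rewrite I_S -!mulrA mulr_suml !mulr_sumr; apply: eq_bigr => b _.
  rewrite I_S -!mulrA mulr_suml !mulr_sumr; apply: eq_bigr => c _.
  by rewrite !mulr_sumr; apply: eq_bigr => d _; ring.
have Esplit : e j.+3 * e 1 =
    S4 (fun a b c d => (b < a)%:R * (a < c)%:R * (b < d)%:R * I j c) +
    S4 (fun a b c d => (b < d)%:R * (d < c)%:R * (a <= b)%:R * I j c).
  rewrite [X in X + _]S4_12 [X in _ + X]S4_12 [X in _ + X]S4_34 [X in _ + X]S4_23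
    [X in _ + X]S4_34 S4D Ecol.
  by apply: eq_S4 => a b c d; rewrite (leE d a); ring.
rewrite Esplit Eprod E22 S4D -[RHS]addrC; apply/eqP; rewrite eq_sym addrC subr_eq; apply/eqP.
rewrite S4D; apply: eq_S4 => a b c d; rewrite -!natrM -!mulrDl -!natrD; congr (_%:R * _).
by move: (ltnP b a) (ltnP d c) (ltnP a c) (ltnP b d); do 4!case; lia.
Qed.

End SchurElem.

Lemma schur_schurw N la : schur N la = schurw N (mvar N) la.
Proof.
rewrite /schurw -sum_ffun_words /schur big_mkcond; apply: eq_bigr => T _ /=.
have -> : \prod_c mvar N (val (T c)) = \prod_c 'X_(T c).
  by apply: eq_bigr => c _; rewrite mvarE.
by case: is_ssyt; rewrite ?mulr1 ?mulr0.
Qed.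

Lemma mesym_elsym N k : mesym N {poly int} k = elsym N (mvar N) k.
Proof.
rewrite -elsym_sorted -sum_tuple_words mesym_tupleE big_mkcond; apply: eq_bigr => h _ /=.
have -> : \prod_(c <- h) mvar N (val c) = \prod_(c <- h) 'X_c.
  by apply: eq_bigr => c _; rewrite mvarE.
by rewrite /tmono; case: sorted; rewrite ?mulr1 ?mulr0.
Qed.

(** * Sums over permutations of a set of letters *)

Definition insert i (a : nat) w := take i w ++ a :: drop i w.

Lemma perm_insert i a w : perm_eq (insert i a w) (a :: w).
Proof. by rewrite /insert perm_catC /= perm_cons perm_catC cat_take_drop. Qed.

Lemma index_insert i a w : (i <= size w)%N -> a \notin w -> index a (insert i a w) = i.
Proof.
move=> lei aw; rewrite /insert index_cat /= eqxx addn0 size_take_min.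
case: ifP => [/mem_take|_]; first by rewrite (negbTE aw).
exact/minn_idPl.
Qed.

Lemma filter_insert i a w : a \notin w -> filter (predC1 a) (insert i a w) = w.
Proof.
move=> aw; rewrite /insert filter_cat /= eqxx /= -filter_cat cat_take_drop.
by apply/all_filterP/allP => c cw; apply: contraNneq aw => <-.
Qed.

Section PermSums.
Context {R : comNzRingType}.
Implicit Types (F G : seq nat -> R) (L : seq nat).

Definition psum L F : R := \sum_(w <- permutations L) F w.

Lemma eq_psum L F G : (forall w, perm_eq w L -> F w = G w) -> psum L F = psum L G.
Proof.
by move=> FG; apply: eq_big_seq => w; rewrite mem_permutations => /FG.
Qed.

Lemma psumZ a L F : psum L (fun w => a * F w) = a * psum L F.
Proof. by rewrite /psum mulr_sumr. Qed.

Lemma psum0 L F : (forall w, perm_eq w L -> F w = 0) -> psum L F = 0.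
Proof. by move=> F0; rewrite /psum big_seq big1 // => w; rewrite mem_permutations => /F0. Qed.

Lemma psum_nil F : psum [::] F = F [::].
Proof. by rewrite /psum big_seq1. Qed.

(** Counting replaces surjectivity: a duplicate-free list of permutations of [L] that is long enough
    contains them all. *)
Lemma psum_uniq_list L (X : seq (seq nat)) F : uniq L -> uniq X ->
  {in X, forall w, perm_eq w L} -> ((size L)`! <= size X)%N ->
  psum L F = \sum_(w <- X) F w.
Proof.
move=> uL uX XL sX; apply/esym/perm_big/uniq_perm => //; first exact: permutations_uniq.
have sub : {subset X <= permutations L} by move=> w /XL; rewrite mem_permutations.
by apply: (uniq_min_size uX sub _).2; rewrite size_permutations.
Qed.

Lemma psum_head L F : (0 < size L)%N -> uniq L ->
  psum L F = \sum_(x <- L) psum (rem x L) (fun w => F (x :: w)).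
Proof.
move=> L0 uL; rewrite /psum (perm_big _ (permutationsE L0)) undup_id //.
by rewrite big_allpairs_dep.
Qed.

Lemma psum_insert a L F : uniq (a :: L) ->
  psum (a :: L) F = psum L (fun w => \sum_(0 <= i < (size L).+1) F (insert i a w)).
Proof.
move=> uaL; have /andP[aL uL] := uaL.
pose X := [seq insert i a w | w <- permutations L, i <- iota 0 (size L).+1].
rewrite (@psum_uniq_list _ X) //; first by rewrite big_allpairs_dep /index_iota subn0.
- apply: allpairs_uniq; [exact: permutations_uniq | exact: iota_uniq |].
  move=> [w i] [w' i'].
  case/allpairsP => -[w1 i1] [w1L i1L [-> ->]].
  case/allpairsP => -[w2 i2] [w2L i2L [-> ->]] /= E.
  move: w1L w2L i1L i2L; rewrite !mem_permutations !mem_iota !add0n !ltnS /= => p1 p2 l1 l2.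
  have a1 : a \notin w1 by rewrite (perm_mem p1).
  have a2 : a \notin w2 by rewrite (perm_mem p2).
  have s1 : (i1 <= size w1)%N by rewrite (perm_size p1).
  have s2 : (i2 <= size w2)%N by rewrite (perm_size p2).
  have ei : i1 = i2 by rewrite -(index_insert s1 a1) E (index_insert s2 a2).
  by rewrite ei -(filter_insert i1 a1) E (filter_insert i2 a2).
- move=> w /allpairsP[[w' i] /= [w'L _ ->]].
  rewrite (perm_trans (perm_insert _ _ _)) // perm_cons.
  by rewrite mem_permutations in w'L.
- by rewrite size_allpairs size_permutations // size_iota [size (a :: L)]/= factS mulnC leqnn.
Qed.

Lemma psum_perm_mx n (F : seq nat -> R) :
  \sum_(s : 'S_n) F [seq (val (s i)).+1 | i <- enum 'I_n] = psum (iota 1 n) F.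
Proof.
pose W (s : 'S_n) := [seq (val (s i)).+1 | i <- enum 'I_n].
have injW : injective W.
  move=> s s' /eq_in_map E; apply/permP => i; apply: val_inj.
  by have /E [] : i \in enum 'I_n by rewrite mem_enum.
have uW s : uniq (W s).
  by rewrite map_inj_uniq ?enum_uniq // => i j [] /val_inj /perm_inj.
rewrite (@psum_uniq_list _ [seq W s | s <- index_enum 'S_n]); first by rewrite big_map.
- exact: iota_uniq.
- by rewrite map_inj_uniq // index_enum_uniq.
- move=> w /mapP[s _ ->]; apply: uniq_perm; rewrite ?iota_uniq //.
  have sub : {subset W s <= iota 1 n}.
    by move=> c /mapP[i _ ->]; rewrite mem_iota add1n ltnS /=; exact: (valP (s i)).
  by apply: (uniq_min_size (uW s) sub _).2; rewrite size_iota size_map size_enum_ord.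
- rewrite size_iota size_map.
  have -> : size (index_enum 'S_n) = #|'S_n| by rewrite cardT enumT.
  by rewrite card_Sn.
Qed.

Lemma pairw_insert (h : nat -> nat -> R) i a w :
  pairw h (insert i a w) =
  pairw h w * (\prod_(c <- take i w) h c a) * \prod_(c <- drop i w) h a c.
Proof.
rewrite -[in RHS](cat_take_drop i w) /insert !pairw_cat /=.
have -> : \prod_(c <- take i w) \prod_(d <- a :: drop i w) h c d =
  (\prod_(c <- take i w) h c a) * \prod_(c <- take i w) \prod_(d <- drop i w) h c d.
  by rewrite -big_split; apply: eq_bigr => c _; rewrite big_cons.
rewrite cat_take_drop; ring.
Qed.

Lemma prod_if_count (t : R) (P : pred nat) w :
  \prod_(c <- w) (if P c then t else 1) = t ^+ count P w.
Proof.
elim: w => [|c w IH]; first by rewrite big_nil.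
by rewrite big_cons IH /=; case: (P c); rewrite ?mul1r // add1n exprS.
Qed.

(** The smallest letter, inserted at position [i], has only larger letters before it, hence exactly
    [i] new inversions; each letter thus contributes a t-integer. *)
Lemma psum_inversions (t : R) h L :
    sorted ltn L ->
    {in L &, forall c d, h c d = if (d < c)%N then t else 1} ->
  psum L (pairw h) = qfact t (size L).
Proof.
elim: L => [|a L IH] sL hL; first by rewrite psum_nil qfact0.
have sL' : sorted ltn L by move: sL => /= /path_sorted.
have uaL : uniq (a :: L) by apply: sorted_uniq sL; [exact: ltn_trans | exact: ltnn].
have minL c : c \in L -> (a < c)%N.
  by move=> cL; move: sL; rewrite /= (path_sortedE ltn_trans) => /andP[/allP/(_ _ cL)].
rewrite psum_insert // /= qfactS -IH //; last first.
  by move=> c d cL dL; apply: hL; rewrite inE ?cL ?dL orbT.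
rewrite mulrC -psumZ; apply: eq_psum => w pw.
have -> : qnum t (size L).+1 = \sum_(0 <= i < (size L).+1) t ^+ i.
  by elim: (size L).+1 => [|k IHk]; rewrite ?big_nil // big_nat_recr //= -IHk.
rewrite mulr_suml; apply: eq_big_nat => i; rewrite ltnS => leiL; rewrite pairw_insert.
rewrite big_seq (eq_bigr (fun=> t)) -?big_seq.
  rewrite [X in _ * X]big_seq [X in _ * X]big1 => [|c /mem_drop cw].
    rewrite big_const_seq count_predT size_take_min (perm_size pw).
    by rewrite (minn_idPl leiL) iter_mulr_1 mulr1 mulrC.
  rewrite hL ?inE ?eqxx // -?(perm_mem pw) ?cw ?orbT //.
  by rewrite ltnNge ltnW // minL // -(perm_mem pw).
move=> c /mem_take cw.
by rewrite hL ?inE ?eqxx // -?(perm_mem pw) ?cw ?orbT // minL // -(perm_mem pw).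
Qed.

(** Used to insert the letter 1 into a column: it may stand directly below a neighbour ([P]), or on
    top if [b] allows, and each neighbour above it is an inversion. The places below neighbours
    weigh t, t^2, and so on. *)
Lemma sum_insert_left (t : R) (P : pred nat) (b : bool) w :
  \sum_(0 <= i < (size w).+1)
     (if i is i'.+1 then P (nth 0%N w i') else b)%:R * t ^+ count P (take i w)
  = b%:R + t * qnum t (count P w).
Proof.
elim/last_ind: w => [|w c IH].
  by rewrite big_nat1 /= qnum0 expr0 mulr1 mulr0 addr0.
rewrite size_rcons big_nat_recr //=.
have -> : \sum_(0 <= i < (size w).+1)
     (if i is i'.+1 then P (nth 0%N (rcons w c) i') else b)%:R
       * t ^+ count P (take i (rcons w c)) = b%:R + t * qnum t (count P w).
  rewrite -IH; apply: eq_big_nat => -[|i] lti //; first by rewrite !take0.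
  by rewrite nth_rcons -cats1 takel_cat // (_ : (i < size w)%N = true) //; lia.
rewrite nth_rcons ltnn eqxx -(size_rcons w c) take_size -cats1 count_cat /= addn0.
case: (P c); last by rewrite mul0r !addr0 addn0.
by rewrite addn1 mul1r qnumS exprS; ring.
Qed.

(** The mirror image for the letter [n], which stands last or directly above a neighbour and is
    inverted with each neighbour below it. *)
Lemma sum_insert_right (t : R) (P : pred nat) w :
  \sum_(0 <= i < (size w).+1)
     ((i == size w) || P (nth 0%N w i))%:R * t ^+ count P (drop i w)
  = qnum t (count P w).+1.
Proof.
elim: w => [|c w IH]; first by rewrite big_nat1 /= mul1r qnumS qnum0 add0r.
rewrite big_nat_recl //= IH.
case: (P c); last by rewrite mul0r add0r add0n.
by rewrite mul1r add1n [in RHS]qnumS addrC.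
Qed.

End PermSums.

(** * Tableau sums as sums over reading words *)

Lemma rowof_lt_index T a b : uniq (flatten T) -> b \in flatten T ->
  (rowof T a < rowof T b)%N -> (index a (flatten T) < index b (flatten T))%N.
Proof.
rewrite /rowof; elim: T => //= row T IH; rewrite cat_uniq mem_cat !index_cat.
case/and3P=> _ disj uT; case: ifP => [ar | _].
  by case: ifP => // _ _ _; rewrite (leq_trans (n := size row)) ?index_mem ?leq_addr.
by case: ifP => //= _ bT lt; rewrite ltn_add2l IH.
Qed.

Lemma rowofP T a : a \in flatten T -> a \in nth [::] T (rowof T a).
Proof.
case/flattenP => row rT ar; apply: (@nth_find _ [::] (fun r => a \in r)).
by apply/hasP; exists row.
Qed.

(** Here [c] precedes [d] in the reading word, so an inversion needs the later letter [d] to be the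
    smaller one. *)
Definition invw m c d : {poly int} := if incedge m d c then 'X else 1.

(** A row is a chain of P, so the ends of an edge never share a row; on edges, lying in a lower row
    is the same as coming later in the reading word. *)
Lemma Bpoly_psum n m la :
    (forall i, (1 <= i <= n - 1)%N -> (i <= m i <= n)%N) -> sumn la = n ->
  Bpoly n m la =
  psum (iota 1 n) (fun w => (is_Ptableau n m (reshape la w))%:R * pairw (invw m) w).
Proof.
move=> nat_m sla; rewrite -psum_perm_mx /Bpoly big_mkcond; apply: eq_bigr => s _.
rewrite /filling; set W := [seq (val (s i)).+1 | i <- enum 'I_n].
set T := reshape la W; case: ifP => [tabT|_]; last by rewrite mul0r.
rewrite mul1r.
have uW : uniq W by rewrite map_inj_uniq ?enum_uniq // => i j [] /val_inj /perm_inj.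
have sW : size W = n by rewrite size_map size_enum_ord.
have fT : flatten T = W by rewrite reshapeKr // sW sla.
have memW c : c \in W -> (1 <= c <= n)%N by case/mapP => i _ ->; exact: (valP (s i)).
have pW : perm_eq (iota 1 n) W.
  rewrite perm_sym; apply: uniq_perm => //; first exact: iota_uniq.
  have sub : {subset W <= iota 1 n} by move=> c /memW; rewrite mem_iota; lia.
  by apply: (uniq_min_size uW sub _).2; rewrite size_iota sW.
have trP : transitive (Plt n m).
  move=> b a c; rewrite /Plt => /and3P[? ? ?] /and3P[? ? ?].
  by have := nat_m b; lia.
have edge_rows a b : a \in W -> b \in W -> incedge m a b -> rowof T a <> rowof T b.
  move=> aW bW eab rab.
  have aT : a \in nth [::] T (rowof T a) by apply: rowofP; rewrite fT.
  have bT : b \in nth [::] T (rowof T a) by rewrite rab; apply: rowofP; rewrite fT.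
  set row := nth _ _ _ in aT bT.
  have rT : row \in T.
    have [ltr|ger] := ltnP (rowof T a) (size T); first exact: mem_nth.
    by move: aT; rewrite /row nth_default.
  have srow : sorted (Plt n m) row by case/andP: tabT => /allP/(_ _ rT).
  have := nat_m a; have := nat_m b; have := memW _ aW; have := memW _ bW.
  move: srow eab; rewrite (sorted_pairwise trP) /incedge => /(pairwiseP 0%N) srow eab.
  have [ia ib] : (index a row < size row)%N /\ (index b row < size row)%N by rewrite !index_mem.
  have := srow (index a row) (index b row) ia ib.
  have := srow (index b row) (index a row) ib ia; rewrite !nth_index // /Plt.
  case: (ltngtP (index a row) (index b row)) => [_ _ /(_ isT)|_ /(_ isT) + _|].
  - by lia.
  - by lia.
  - by move=> E; have := nth_index 0%N aT; rewrite E nth_index // => ?; lia.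
have -> : ('X : {poly int}) ^+ invG n m T = \prod_(a <- W) \prod_(b <- W)
    (if (index b W < index a W)%N then invw m b a else 1).
  pose f a b : {poly int} := if incedge m a b && (rowof T b < rowof T a)%N then 'X else 1.
  have ordE (g : nat -> {poly int}) : \prod_(a < n) g a.+1 = \prod_(a <- W) g a.
    rewrite -(perm_big _ pW) -(big_mkord predT (fun a => g a.+1)) -(big_add1 _ _ 0%N n.+1 predT g).
    by rewrite /index_iota subn1.
  transitivity (\prod_(a < n) \prod_(b < n) f a.+1 b.+1).
    rewrite pair_bigA /invG -prodr_const big_mkcond; apply: eq_bigr => -[a b] _ /=.
    by rewrite inE.
  rewrite (ordE (fun a => \prod_(b < n) f a b.+1)) big_seq [RHS]big_seq.
  apply: eq_bigr => a aW; rewrite (ordE (f a)) big_seq [RHS]big_seq; apply: eq_bigr => b bW.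
  rewrite /f /invw; case e: (incedge m a b) => /=; last by case: ifP.
  have ne := edge_rows _ _ aW bW e.
  have [lt|gt|eq] := ltngtP (rowof T b) (rowof T a); last by case: ne.
    by have := rowof_lt_index (T := T); rewrite fT => /(_ _ _ uW aW lt) ->.
  have := rowof_lt_index (T := T); rewrite fT => /(_ _ _ uW bW gt) lt.
  by rewrite ltnNge ltnW.
rewrite exchange_big -pairw_nth (big_nth 0%N) big_nat [RHS]big_nat.
apply: eq_bigr => i /andP[_ ltiW]; rewrite (big_nth 0%N) big_nat [RHS]big_nat.
by apply: eq_bigr => j /andP[_ ltjW]; rewrite !index_uniq.
Qed.

Lemma sum_expr_qnum (R : comNzRingType) (t : R) k : \sum_(0 <= i < k) t ^+ i = qnum t k.
Proof. by elim: k => [|k IHk]; rewrite ?big_nil // big_nat_recr //= IHk. Qed.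

Lemma count_lt_iota a k y : (a <= y <= a + k)%N -> count (fun d => d < y)%N (iota a k) = (y - a)%N.
Proof.
move=> le; have -> : k = ((y - a) + (a + k - y))%N by lia.
rewrite iotaD count_cat.
have /eqP -> : count (fun d => d < y)%N (iota a (y - a)) == size (iota a (y - a)).
  by rewrite -all_count; apply/allP => d; rewrite mem_iota; lia.
rewrite size_iota; have /eqP -> : count (fun d => d < y)%N (iota (a + (y - a)) (a + k - y)) == 0%N.
  by rewrite -leqn0 leqNgt -has_count; apply/hasP => -[d]; rewrite mem_iota; lia.
by rewrite addn0.
Qed.

Lemma sorted_cat_cons (T : Type) (r : rel T) s1 a s2 :
  sorted r (s1 ++ a :: s2) = sorted r (rcons s1 a) && path r a s2.
Proof. by case: s1 => [|b s1] //=; rewrite cat_path rcons_path /= andbA. Qed.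

Lemma psum_perm (R : comNzRingType) L L' (F : seq nat -> R) :
  uniq L -> perm_eq L L' -> psum L F = psum L' F.
Proof.
move=> uL pL; apply: psum_uniq_list => //; first exact: permutations_uniq.
  by move=> w; rewrite mem_permutations => pw; rewrite perm_sym (perm_trans pL) // perm_sym.
by rewrite size_permutations -?(perm_uniq pL) // (perm_size pL).
Qed.

Lemma psum_head_cons (R : comNzRingType) a L (F : seq nat -> R) : uniq (a :: L) ->
  psum (a :: L) F = psum L (fun w => F (a :: w))
    + \sum_(x <- L) psum (a :: rem x L) (fun w => F (x :: w)).
Proof.
move=> uaL; rewrite psum_head // big_cons /= eqxx; congr (_ + _).
apply: eq_big_seq => x xL; case: eqP => [E|//].
by move: uaL; rewrite /= E xL.
Qed.

(** The elements of a sorted list have ranks 0, 1, 2, ...; this sums the inversions of a letter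
    placed before all the others of its clique. *)
Lemma sum_rank (R : comNzRingType) (t : R) b L : sorted ltn L ->
  \sum_(z <- L) (z < b)%:R * t ^+ count (fun d => d < z)%N L =
  qnum t (count (fun d => d < b)%N L).
Proof.
elim: L => [|a L IH] sL; first by rewrite big_nil qnum0.
have sL' : sorted ltn L by move: sL => /= /path_sorted.
have minL c : c \in L -> (a < c)%N.
  by move=> cL; move: sL; rewrite /= (path_sortedE ltn_trans) => /andP[/allP/(_ _ cL)].
have count0 y : (y <= a)%N -> count (fun d => d < y)%N L = 0%N.
  move=> leya; apply/eqP; rewrite -leqn0 leqNgt -has_count; apply/hasP => -[d /minL].
  by lia.
rewrite big_cons /= ltnn count0 //= expr0 mulr1.
have -> : \sum_(z <- L) (z < b)%:R * t ^+ ((a < z) + count (fun d => d < z) L)%N =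
  t * qnum t (count (fun d => d < b)%N L).
  rewrite -IH // mulr_sumr; apply: eq_big_seq => z zL.
  by rewrite minL // add1n exprS; ring.
case: ltnP => [_|leb]; first by rewrite add1n qnumSl.
by rewrite count0 // qnum0 mulr0 addr0.
Qed.

(** * The four tableau sums *)

(* Letters: [1] is the minimal vertex, [n] the maximal one, and the clique
   [2 .. n - 1] splits into the [p] neighbours of [1], [v] free letters and the
   [q] neighbours of [n]. *)
Section TableauSums.
Context {R : comNzRingType} (t : R) (p v q : nat).
Let k := (p + v + q)%N.
Let n := k.+2.
Let M := iota 2 k.
Context (h : nat -> nat -> R) (lt : rel nat).
Hypothesis h_mm : {in M &, forall c d, h c d = if (d < c)%N then t else 1}.
Hypothesis h_m1 : {in M, forall c, h c 1%N = if (c < p.+2)%N then t else 1}.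
Hypothesis h_nm : {in M, forall c, h n c = if (p + v + 2 <= c)%N then t else 1}.
Hypothesis h_1m : {in M, forall c, h 1%N c = 1}.
Hypothesis h_mn : {in M, forall c, h c n = 1}.
Hypothesis h_1n : h 1%N n = 1.
Hypothesis h_n1 : h n 1%N = 1.
Hypothesis lt_mm : {in M &, forall c d, lt c d = false}.
Hypothesis lt_1m : {in M, forall c, lt 1%N c = (p.+1 < c)%N}.
Hypothesis lt_mn : {in M, forall c, lt c n = (c < p + v + 2)%N}.
Hypothesis lt_m1 : {in M, forall c, lt c 1%N = false}.
Hypothesis lt_nm : {in M, forall c, lt n c = false}.
Hypothesis lt_1n : lt 1%N n.
Hypothesis lt_n1 : lt n 1%N = false.

Let cr : rel nat := fun a b => ~~ lt b a.
Local Notation "[ k ]q" := (qnum t k) (at level 0, format "[ k ]q").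
Local Notation "k `!q" := (qfact t k) (at level 2, format "k `!q").

Definition tabsum la :=
  psum (1%N :: n :: M) (fun w => (tableau lt cr (reshape la w))%:R * pairw h w).

Let memM c : (c \in M) = (2 <= c < n)%N.
Proof. by rewrite mem_iota /n add2n. Qed.

Let uM : uniq M. Proof. exact: iota_uniq. Qed.
Let nM : n \notin M. Proof. by rewrite memM ltnn andbF. Qed.
Let oM : 1%N \notin M. Proof. by rewrite memM. Qed.
Let uL : uniq (1%N :: n :: M).
Proof. by rewrite /= nM uM inE negb_or oM. Qed.

Let sumM (f : nat -> R) : \sum_(c <- M) f c =
  \sum_(0 <= i < p) f i.+2 + \sum_(0 <= i < v) f (p + i).+2
   + \sum_(0 <= i < q) f (p + v + i).+2.
Proof.
have E a j : \sum_(c <- iota a j) f c = \sum_(0 <= i < j) f (a + i)%N.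
  by rewrite -{1}[a]addn0 iotaDl big_map /index_iota subn0.
by rewrite /M /k !iotaD !big_cat /= !E; congr (_ + _ + _); apply: eq_bigr => i _; congr f; lia.
Qed.

Let sub (L : seq nat) := {subset L <= M}.
Let sub_rem x : sub (rem x M). Proof. by move=> c /mem_rem. Qed.
Let sorted_M : sorted ltn M. Proof. exact: iota_ltn_sorted. Qed.
Let sorted_rem x L : sorted ltn L -> sorted ltn (rem x L).
Proof. by apply: subseq_sorted; [exact: ltn_trans | exact: rem_subseq]. Qed.

Let sorted_mid w : sub w -> sorted cr w.
Proof.
move=> wM; case: w wM => //= c w; elim: w c => //= d w IH c wM.
rewrite /cr lt_mm /= ?IH // ?wM ?inE ?eqxx ?orbT // => b bw.
by apply: wM; rewrite inE bw orbT.
Qed.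

Let path_mid a w : sub w -> {in M, forall c, lt c a = false} -> path cr a w.
Proof.
move=> wM la; have := sorted_mid wM; case: w wM => //= c w wM ->.
by rewrite /cr la // wM // inE eqxx.
Qed.

Let inversions L : sub L -> sorted ltn L -> psum L (pairw h) = (size L)`!q.
Proof.
move=> LM sL; apply: psum_inversions => // c d cL dL.
by apply: h_mm; apply: LM.
Qed.

Let count_nbr1 : count (fun d => d < p.+2)%N M = p.
Proof. by rewrite count_lt_iota /k; lia. Qed.

Let count_nbrn : count (fun d => p + v + 2 <= d)%N M = q.
Proof.
have := count_predC (fun d => d < p + v + 2)%N M.
rewrite count_lt_iota /k ?size_iota; last by lia.
rewrite (eq_count (a1 := predC _) (a2 := fun d => p + v + 2 <= d)%N); first by lia.
by move=> d; rewrite /= -leqNgt.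
Qed.

Let prod_nm w : sub w -> \prod_(c <- w) h n c = t ^+ count (fun d => p + v + 2 <= d)%N w.
Proof.
move=> wM; rewrite -prod_if_count big_seq [RHS]big_seq; apply: eq_bigr => c cw.
by rewrite h_nm // wM.
Qed.

Let prod_mm x w : x \in M -> sub w ->
  \prod_(c <- w) h x c = t ^+ count (fun d => d < x)%N w.
Proof.
move=> xM wM; rewrite -prod_if_count big_seq [RHS]big_seq; apply: eq_bigr => c cw.
by rewrite h_mm // wM.
Qed.

Let prod_1 w : {subset w <= n :: M} -> \prod_(c <- w) h 1%N c = 1.
Proof.
move=> wM; rewrite big_seq big1 // => c /wM; rewrite inE => /predU1P[->|] //; exact: h_1m.
Qed.

Let prod_mn w : sub w -> \prod_(c <- w) h c n = 1.
Proof. by move=> wM; rewrite big_seq big1 // => c /wM /h_mn. Qed.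

Let prod_m1 w : {subset w <= n :: M} ->
  \prod_(c <- w) h c 1%N = t ^+ count (fun d => d < p.+2)%N w.
Proof.
move=> wM; rewrite -prod_if_count big_seq [RHS]big_seq; apply: eq_bigr => c /wM.
rewrite inE => /predU1P[->|/h_m1 //]; rewrite h_n1 ifF //.
by apply/negbTE; rewrite -leqNgt /n /k; lia.
Qed.

(** The letter just above 1 must be a neighbour of 1. It is then a middle letter, below which any
    letter of [u] may follow, so deleting 1 keeps the column admissible. *)
Let sorted_insert1 i u : {subset u <= n :: M} -> (i <= size u)%N ->
  sorted cr (insert i 1%N u) =
  (if i is i'.+1 then (nth 0%N u i' < p.+2)%N else true) && sorted cr u.
Proof.
move=> uMn lei.
have path1 w : {subset w <= n :: M} -> path cr 1%N w = sorted cr w.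
  case: w => //= c w wM; rewrite /cr (_ : lt c 1%N = false) //.
  have /wM : c \in c :: w by rewrite inE eqxx.
  by rewrite inE => /predU1P[->|/lt_m1].
case: i lei => [|i] lei; first by rewrite /insert take0 drop0 /= path1.
have uE : u = take i u ++ nth 0%N u i :: drop i.+1 u by rewrite -drop_nth // cat_take_drop.
have sub_drop : {subset drop i.+1 u <= n :: M} by move=> c /mem_drop /uMn.
rewrite /insert (take_nth 0%N) // cat_rcons sorted_cat_cons /= path1 //.
have -> : sorted cr u = sorted cr (rcons (take i u) (nth 0%N u i)) && path cr (nth 0%N u i) (drop i.+1 u).
  by rewrite {1}uE sorted_cat_cons.
have ciM : nth 0%N u i \in n :: M by apply/uMn/mem_nth.
set c := nth 0%N u i in ciM *.
have -> : cr c 1%N = (c < p.+2)%N.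
  rewrite /cr; move: ciM; rewrite inE => /predU1P[->|cM]; last by rewrite lt_1m // -leqNgt.
  by rewrite lt_1n /= /n /k; lia.
rewrite andbCA; case: ltnP => //= ltc; congr andb.
have cM : c \in M.
  by move: ciM; rewrite inE => /predU1P[cn|//]; move: ltc; rewrite cn /n /k; lia.
case: (drop i.+1 u) sub_drop => //= d w wM.
suff -> : cr c d by [].
have /wM : d \in d :: w by rewrite inE eqxx.
by rewrite /cr inE => /predU1P[->|dM]; rewrite ?lt_nm ?lt_mm.
Qed.

Let sorted_insertn j u : sub u -> (j <= size u)%N ->
  sorted cr (insert j n u) = (j == size u) || (p + v + 2 <= nth 0%N u j)%N.
Proof.
move=> uMn lej; rewrite /insert sorted_cat_cons.
have -> : sorted cr (rcons (take j u) n).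
  have tM : sub (take j u) by move=> c /mem_take /uMn.
  have := sorted_mid tM; case: (take j u) tM => //= c w cwM pw.
  by rewrite rcons_path pw /= /cr lt_nm // cwM // mem_last.
have [->|nej] := eqVneq j (size u); first by rewrite drop_size.
have ltj : (j < size u)%N by rewrite ltn_neqAle nej.
rewrite (drop_nth 0%N ltj) /=.
have cM : nth 0%N u j \in M by apply/uMn/mem_nth.
rewrite (@path_mid _ (drop j.+1 u)); last 2 first.
- by move=> c /mem_drop /uMn.
- by move=> c cM'; rewrite lt_mm.
by rewrite andbT /cr lt_mn // -leqNgt.
Qed.

Let insertn L : sub L -> sorted ltn L ->
  psum (n :: L) (fun w => (sorted cr w)%:R * pairw h w) =
  (size L)`!q * [(count (fun d => p + v + 2 <= d)%N L).+1]q.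
Proof.
move=> LM sL.
have uL' : uniq (n :: L).
  rewrite /= (contra (@LM n)) //=.
  by apply: sorted_uniq sL; [exact: ltn_trans | exact: ltnn].
rewrite psum_insert // -inversions // mulrC -psumZ; apply: eq_psum => w pw.
have wM : sub w by move=> c; rewrite (perm_mem pw) => /LM.
rewrite -(seq.permP pw) -sum_insert_right mulr_suml (perm_size pw).
apply: eq_big_nat => i /andP[_ ltiL]; rewrite ltnS in ltiL.
rewrite sorted_insertn //; last by rewrite (perm_size pw).
rewrite pairw_insert prod_mn ?prod_nm; last 2 first.
- by move=> c /mem_drop /wM.
- by move=> c /mem_take /wM.
by rewrite (perm_size pw); ring.
Qed.

(** Inserting [n] into the middle word gives [q+1]; inserting 1 into the result gives [p+1], as [n]
    is not a neighbour of 1. *)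
Lemma tabsum_1 : tabsum (nseq n 1%N) = k`!q * [p.+1]q * [q.+1]q.
Proof.
have -> : k`!q * [p.+1]q * [q.+1]q =
  psum (n :: M) (fun w => [p.+1]q * ((sorted cr w)%:R * pairw h w)).
  by rewrite psumZ insertn // count_nbrn size_iota; ring.
rewrite /tabsum psum_insert //; apply: eq_psum => u pu.
have uMn : {subset u <= n :: M} by move=> c; rewrite (perm_mem pu).
have su : size u = n.-1 by rewrite (perm_size pu) /= size_iota.
have cu : count (fun d => d < p.+2)%N u = p.
  by rewrite (seq.permP pu) /= count_nbr1 ltnNge /n /k; lia.
have <- : true%:R + t * [p]q = [p.+1]q by rewrite qnumSl.
rewrite -{1}cu -(sum_insert_left t _ true) mulr_suml /= size_iota su.
apply: eq_big_nat => i /andP[_ ltik].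
have lei : (i <= size u)%N by rewrite su.
have -> : tableau lt cr (reshape (nseq n 1%N) (insert i 1%N u)) = sorted cr (insert i 1%N u).
  rewrite reshape_ones; last by rewrite (perm_size (perm_insert _ _ _)) /= su.
  by case: (insert i 1%N u) => [|a w] //; rewrite tableau_hook.
rewrite sorted_insert1 // pairw_insert prod_1 ?prod_m1; last 2 first.
- by move=> c /mem_take /uMn.
- by move=> c /mem_drop /uMn.
case: i {ltik lei} => [|i]; first by rewrite andTb; ring.
by case: (nth _ _ _ < _)%N; rewrite /=; ring.
Qed.

Hypothesis k_gt0 : (0 < k)%N.

Let remMn x : x \in M -> rem x (n :: M) = n :: rem x M.
Proof. by move=> xM; rewrite /=; case: eqP => // E; move: nM; rewrite E xM. Qed.

Let size_rem x : x \in M -> size (rem x M) = k.-1.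
Proof. by move=> xM; rewrite seq.size_rem // size_iota. Qed.

Let u_rem x (L : seq nat) : uniq L -> uniq (rem x L). Proof. exact: rem_uniq. Qed.

Let un (L : seq nat) : sub L -> uniq L -> uniq (n :: L).
Proof. by move=> LM uL' /=; rewrite uL' andbT; apply: contra nM => /LM. Qed.

Let u1 (L : seq nat) : sub L -> uniq L -> uniq (1%N :: L).
Proof. by move=> LM uL' /=; rewrite uL' andbT; apply: contra oM => /LM. Qed.

Let un1 (L : seq nat) : sub L -> uniq L -> uniq (n :: 1%N :: L).
Proof.
move=> LM uL'; rewrite [uniq _]/= -/(uniq (1%N :: L)) u1 // andbT inE negb_or.
by rewrite (contra (@LM n)) //= andbT.
Qed.

(** The first row starts with a relation of P, and the only candidates are 1 before [n], 1 before a
    middle [y], and a middle [a] before [n]. *)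
Let psum2 (F : seq nat -> R) :
    (forall a b w, size w = k -> ~~ lt a b -> F [:: a, b & w] = 0) ->
  psum (1%N :: n :: M) F = psum M (fun w => F [:: 1%N, n & w])
    + \sum_(y <- M) psum (n :: rem y M) (fun w => F [:: 1%N, y & w])
    + \sum_(a <- M) psum (1%N :: rem a M) (fun w => F [:: a, n & w]).
Proof.
move=> F0; rewrite psum_head_cons // (psum_head_cons (L := M)) ?un //; congr (_ + _ + _).
rewrite big_cons [rem n _]/= eqxx psum0 ?add0r => [|w pw]; last first.
  case: w pw => [/perm_size //|y w] pw; apply: F0; first by have /= := perm_size pw; rewrite size_iota => -[].
  have : y \in 1%N :: M by rewrite -(perm_mem pw) inE eqxx.
  by rewrite inE => /predU1P[->|yM]; rewrite ?lt_n1 ?lt_nm.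
apply: eq_big_seq => a aM; rewrite remMn //.
have pa : perm_eq (1%N :: n :: rem a M) (n :: 1%N :: rem a M).
  by rewrite -[X in perm_eq X]/([:: 1%N] ++ [:: n] ++ rem a M) perm_catCA.
rewrite (psum_perm _ _ pa); last by rewrite (perm_uniq pa) un1 // u_rem.
rewrite psum_head_cons ?un1 ?u_rem // big_seq big1 ?addr0 // => y yM.
apply: psum0 => w pw.
have yM1 : y \in 1%N :: M by move: yM; rewrite !inE => /predU1P[->|/mem_rem ->]; rewrite ?eqxx ?orbT.
apply: F0.
  have E : size (rem y (1%N :: rem a M)) = k.-1.
    by rewrite seq.size_rem // -[size (1%N :: _)]/(size (rem a M)).+1 size_rem.
  by rewrite (perm_size pw) -[size (n :: _)]/(size (rem y (1%N :: rem a M))).+1 E prednK.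
by move: yM1; rewrite inE => /predU1P[->|y'M]; rewrite ?lt_m1 ?lt_mm.
Qed.

Let count_lt_rem x : x \in M -> count (fun d => d < x)%N (rem x M) = (x - 2)%N.
Proof.
move=> xM; rewrite count_rem ltnn andbF subn0 count_lt_iota //.
by move: xM; rewrite memM /n; lia.
Qed.

Let count_nbrn_rem x : x \in M ->
  count (fun d => p + v + 2 <= d)%N (rem x M) = (q - (p + v + 2 <= x))%N.
Proof. by move=> xM; rewrite count_rem xM count_nbrn. Qed.

Let sub_perm w L : sub L -> perm_eq w L -> sub w.
Proof. by move=> LM pw c; rewrite (perm_mem pw) => /LM. Qed.

(** The terms belong to the first rows 1 n, then 1 y with [y] free, then 1 y with [y] a neighbour of
    [n], then a n. In the third, [y] is lost as a neighbour below [n], hence [q] in place of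
    [q+1]. *)
Lemma tabsum_21 : tabsum (2 :: nseq k 1)%N =
  k.-1`!q * (t ^+ q * [k]q + t ^+ p * [v]q * [q.+1]q + t ^+ (p + v) * [q]q * [q]q
             + t ^+ q.+1 * [p + v]q * [p]q).
Proof.
have tabE a b w : size w = k ->
    tableau lt cr (reshape (2 :: nseq k 1)%N [:: a, b & w]) = lt a b && path cr a w.
  by move=> sw; rewrite /= take0 drop0 reshape_ones // tableau_hook /= andbT.
rewrite /tabsum psum2; last by move=> a b w sw /negbTE nab; rewrite tabE // nab mul0r.
have -> : psum M (fun w => (tableau lt cr (reshape (2 :: nseq k 1)%N [:: 1%N, n & w]))%:R
      * pairw h [:: 1%N, n & w]) = k.-1`!q * (t ^+ q * [k]q).
  have -> : k.-1`!q * (t ^+ q * [k]q) = t ^+ q * k`!q.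
    by rewrite -[in k`!q](prednK k_gt0) qfactS prednK //; ring.
  rewrite -{2}(size_iota 2 k) -inversions // -psumZ; apply: eq_psum => w pw.
  have wM := sub_perm (fun c cM => cM) pw.
  rewrite tabE ?(perm_size pw) ?size_iota // lt_1n path_mid // mul1r /=.
  rewrite prod_nm // (seq.permP pw) count_nbrn -[\prod_(d <- n :: w) _]/(\prod_(d <- n :: w) h 1%N d) prod_1 ?mul1r //.
  by move=> c; rewrite !inE => /predU1P[->|/wM ->]; rewrite ?eqxx ?orbT.
have -> : \sum_(y <- M) psum (n :: rem y M) (fun w =>
     (tableau lt cr (reshape (2 :: nseq k 1)%N [:: 1%N, y & w]))%:R * pairw h [:: 1%N, y & w])
   = k.-1`!q * (t ^+ p * [v]q * [q.+1]q + t ^+ (p + v) * [q]q * [q]q).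
  transitivity (\sum_(y <- M) (p.+1 < y)%:R * t ^+ (y - 2) *
      (k.-1`!q * [(q - (p + v + 2 <= y)).+1]q)).
    apply: eq_big_seq => y yM.
    rewrite -count_nbrn_rem // -(size_rem yM) -insertn // -?psumZ; last exact: sorted_rem.
    apply: eq_psum => w pw.
    have wM : {subset w <= n :: M}.
      by move=> c; rewrite (perm_mem pw) !inE => /predU1P[->|/mem_rem ->]; rewrite ?eqxx ?orbT.
    rewrite tabE; last by rewrite (perm_size pw) /= size_rem // prednK.
    rewrite lt_1m //.
    have -> : path cr 1%N w = sorted cr w.
      case: w {pw} wM => //= c w wM; rewrite /cr (_ : lt c 1%N = false) //.
      have /wM : c \in c :: w by rewrite inE eqxx.
      by rewrite inE => /predU1P[->|/lt_m1].
    rewrite -mulnb natrM /= -[\prod_(d <- y :: w) _]/(\prod_(d <- y :: w) h 1%N d).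
    rewrite prod_1; last by move=> c; rewrite inE => /predU1P[->|/wM //]; rewrite inE yM orbT.
    rewrite (perm_big _ pw) /= big_cons h_mn // prod_mm // count_lt_rem //; ring.
  rewrite sumM [X in X + _ + _]big_nat [X in X + _ + _]big1 ?add0r; last first.
    by move=> i lti; rewrite (_ : (p.+1 < i.+2)%N = false) ?mul0r //; move: lti; clear; lia.
  rewrite mulrDr; congr (_ + _).
    rewrite -[[v]q]sum_expr_qnum mulr_sumr mulr_suml mulr_sumr; apply: eq_big_nat => i lti.
    rewrite (_ : (p.+1 < (p + i).+2)%N = true); last by clear; lia.
    rewrite (_ : (p + v + 2 <= (p + i).+2)%N = false); last by move: lti; clear; lia.
    by rewrite subn0 subn2 /= exprD; ring.
  rewrite -[X in _ * X * _]sum_expr_qnum mulr_sumr mulr_suml mulr_sumr; apply: eq_big_nat => i lti.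
  rewrite (_ : (p.+1 < (p + v + i).+2)%N = true); last by move: lti; clear; lia.
  rewrite (_ : (p + v + 2 <= (p + v + i).+2)%N = true); last by move: lti; clear; lia.
  by rewrite subn1 prednK ?subn2 /= ?exprD; [ring | move: lti; clear; lia].
have -> : \sum_(a <- M) psum (1%N :: rem a M) (fun w =>
     (tableau lt cr (reshape (2 :: nseq k 1)%N [:: a, n & w]))%:R * pairw h [:: a, n & w])
   = k.-1`!q * (t ^+ q.+1 * [p + v]q * [p]q); last by ring.
transitivity (\sum_(a <- M) (a < p + v + 2)%:R * t ^+ count (fun d => d < a)%N M
    * (k.-1`!q * (t ^+ q.+1 * [p]q))).
  apply: eq_big_seq => a aM.
  rewrite psum_insert ?u1 ?u_rem // -(size_rem aM) -inversions //; last exact: sorted_rem.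
  rewrite [RHS]mulrCA [RHS]mulrC -psumZ; apply: eq_psum => w pw.
  have wM := sub_perm (@sub_rem a) pw.
  have awM : sub (a :: w) by move=> c; rewrite inE => /predU1P[->|/wM].
  have paw : perm_eq (a :: w) M by rewrite perm_sym (perm_trans (perm_to_rem aM)) // perm_cons perm_sym.
  have ca : count (fun d => d < p.+2)%N (a :: w) = p by rewrite (seq.permP paw) count_nbr1.
  have sw : size w = k.-1 by rewrite (perm_size pw) size_rem.
  (* [a] heads the first column, so 1 cannot be placed above it: hence [false]. *)
  have := sum_insert_left t (fun d => d < p.+2)%N false (a :: w).
  rewrite ca add0r big_nat_recl // [X in X + _]mul0r add0r exprS => E.
  have -> : t * t ^+ q * [p]q = t ^+ q * (t * [p]q) by ring.
  rewrite -E !(mulr_sumr, mulr_suml) size_rem // -sw.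
  apply: eq_big_nat => i /andP[_ lti]; rewrite ltnS in lti.
  rewrite tabE; last by rewrite (perm_size (perm_insert _ _ _)) /= sw prednK.
  rewrite lt_mn //; case: ltnP => lta; last by rewrite !mul0r.
  have -> : path cr a (insert i 1%N w) = (nth 0%N (a :: w) i < p.+2)%N.
    have := @sorted_insert1 i.+1 (a :: w); rewrite (sorted_mid awM) andbT => <- //.
    by move=> c /awM cM; rewrite inE cM orbT.
  have cn : count (fun d => p + v + 2 <= d)%N w = q.
    by rewrite (seq.permP pw) count_nbrn_rem // [(_ <= a)%N]leqNgt lta subn0.
  have ca2 : count (fun d => d < a)%N w = count (fun d => d < a)%N M.
    by rewrite -(seq.permP paw) /= ltnn.
  have prodI f : \prod_(d <- insert i 1%N w) f d = f 1%N * \prod_(d <- w) f d :> R.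
    by rewrite (perm_big _ (perm_insert _ _ _)) big_cons.
  rewrite [pairw _ _]/= big_cons !prodI pairw_insert h_mn // h_n1 (prod_nm wM) (prod_mm aM wM) cn ca2.
  rewrite prod_m1; last by move=> c /mem_take /wM cM; rewrite inE cM orbT.
  rewrite prod_1; last by move=> c /mem_drop /wM cM; rewrite inE cM orbT.
  rewrite h_m1 // [take i.+1 _]/= [count _ (a :: _)]/= exprD.
  by case: (a < p.+2)%N => /=; rewrite ?expr1 ?expr0; ring.
rewrite -mulr_suml sum_rank // count_lt_iota; last by rewrite /k; lia.
by rewrite addnK; ring.
Qed.

(** The first row is 1 y n with [y] free. All [q] neighbours of [n] lie below it, and the free
    letters have ranks p, ..., p + v - 1. *)
Lemma tabsum_31 : tabsum (3 :: nseq k.-1 1)%N = k.-1`!q * (t ^+ (p + q) * [v]q).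
Proof.
have tabE a b c w : size w = k.-1 ->
    tableau lt cr (reshape (3 :: nseq k.-1 1)%N [:: a, b, c & w]) =
    [&& lt a b, lt b c & path cr a w].
  by move=> sw; rewrite /= take0 drop0 reshape_ones // tableau_hook /= andbT andbA.
rewrite /tabsum psum2; last first.
  move=> a b [|c w]; first by move=> /= E; move: k_gt0; rewrite -E.
  by move=> [sw] /negbTE nab; rewrite tabE // ?nab ?mul0r // -sw.
rewrite psum0 ?add0r; last first.
  move=> [|c w] pw; first by have /= := perm_size pw; rewrite size_iota => E; move: k_gt0; rewrite -E.
  have sw : size w = k.-1 by have /= := perm_size pw; rewrite size_iota => <-.
  by rewrite tabE // lt_nm ?andbF ?mul0r // -(perm_mem pw) inE eqxx.
rewrite [X in _ + X]big_seq [X in _ + X]big1 ?addr0; last first.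
  move=> a aM; apply: psum0 => -[|c w] pw; first by have := perm_size pw.
  have sw : size w = k.-1 by have /= := perm_size pw; rewrite size_rem // => -[].
  have : c \in 1%N :: rem a M by rewrite -(perm_mem pw) inE eqxx.
  by rewrite tabE // inE => /predU1P[->|/mem_rem cM]; rewrite ?lt_n1 ?lt_nm ?andbF ?mul0r.
transitivity (\sum_(y <- M) ((p.+1 < y) && (y < p + v + 2))%N%:R * t ^+ (y - 2) *
      (k.-1`!q * t ^+ (q - (p + v + 2 <= y)))).
  apply: eq_big_seq => y yM.
  have nrem : uniq (n :: rem y M) by apply: un; [exact: sub_rem | exact: u_rem].
  rewrite psum_head_cons // [X in _ + X]big_seq [X in _ + X]big1 ?addr0; last first.
    move=> c cM; have cM' := mem_rem cM; apply: psum0 => w pw.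
    rewrite tabE ?(lt_mm yM cM') ?andbF ?mul0r //.
    rewrite (perm_size pw) /= seq.size_rem // size_rem // prednK //.
    by rewrite -(size_rem yM); case: (rem y M) cM.
  rewrite -[in RHS](size_rem yM) -inversions //; last exact: sorted_rem.
  rewrite [X in _ * X]mulrC mulrA -psumZ; apply: eq_psum => w pw.
  have wM := sub_perm (@sub_rem y) pw.
  rewrite tabE ?(perm_size pw) ?size_rem // lt_1m // lt_mn // path_mid // andbT.
  rewrite [pairw _ _]/= -[\prod_(d <- [:: y, n & w]) _]/(\prod_(d <- [:: y, n & w]) h 1%N d) prod_1; last first.
    by move=> c; rewrite !inE => /or3P[/eqP->|/eqP->|/wM->]; rewrite ?yM ?eqxx ?orbT.
  rewrite big_cons h_mn // (prod_nm wM) (prod_mm yM wM) !(seq.permP pw).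
  by rewrite count_lt_rem // count_nbrn_rem //; ring.
rewrite sumM [X in X + _ + _]big_nat [X in X + _ + _]big1 ?add0r; last first.
  by move=> i lti; rewrite (_ : (p.+1 < i.+2)%N = false) ?mul0r //; move: lti; clear; lia.
rewrite [X in _ + X]big_nat [X in _ + X]big1 ?addr0; last first.
  by move=> i lti; rewrite (_ : ((p + v + i).+2 < p + v + 2)%N = false) ?andbF ?mul0r //; clear; lia.
rewrite -[[v]q]sum_expr_qnum !mulr_sumr; apply: eq_big_nat => i lti.
rewrite (_ : (p.+1 < (p + i).+2)%N = true); last by clear; lia.
rewrite (_ : ((p + i).+2 < p + v + 2)%N = true); last by move: lti; clear; lia.
rewrite (_ : (p + v + 2 <= (p + i).+2)%N = false); last by move: lti; clear; lia.
by rewrite subn0 subn2 /= !exprD; ring.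
Qed.

Hypothesis k_gt1 : (1 < k)%N.
Hypothesis v_gt0 : (0 < v)%N.

(** A first row 1 n would leave a second row inside the middle clique. So the top rows are 1 y over
    z n, or a n over 1 y; in the latter the columns force [a] to be a neighbour of 1 and [y] one of
    [n], whence the term in [p][q]. *)
Lemma tabsum_22 : tabsum (2 :: 2 :: nseq k.-2 1)%N =
  k.-2`!q * (t ^+ k.-1 * [q]q * [p + v]q + t ^+ (p + q) * [v]q * [(p + v).-1]q
             + t ^+ k * [p]q * [q]q).
Proof.
have tabE a b c d w : size w = k.-2 ->
    tableau lt cr (reshape (2 :: 2 :: nseq k.-2 1)%N [:: a, b, c, d & w]) =
    [&& lt a b, lt c d, cr a c, cr b d & path cr c w].
  move=> sw; rewrite /= take0 drop0 reshape_ones // tableau_cons2 tableau_hook /= !andbT.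
  by case: (lt a b); case: (lt c d); case: (cr a c); case: (cr b d).
rewrite /tabsum; set F := fun w : seq nat => _.
have FE a b c d w : size w = k.-2 -> F [:: a, b, c, d & w] =
  [&& lt a b, lt c d, cr a c, cr b d & path cr c w]%:R * pairw h [:: a, b, c, d & w].
  by move=> sw; rewrite /F tabE.
have F0 a b c d w : size w = k.-2 -> ~~ lt a b || ~~ lt c d -> F [:: a, b, c, d & w] = 0.
  by move=> sw; rewrite FE // => /orP[] /negbTE->; rewrite ?andbF mul0r.
have size2 (w : seq nat) : size w = k -> exists c d w', w = [:: c, d & w'] /\ size w' = k.-2.
  case: w => [|c [|d w]] /= E; [by move: k_gt1; rewrite -E | by move: k_gt1; rewrite -E |].
  by exists c, d, w; rewrite -E.
have size_rem2 x y : x \in M -> y \in rem x M -> size (rem y (rem x M)) = k.-2.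
  by move=> xM yM; rewrite seq.size_rem // size_rem.
rewrite psum2; last first.
  by move=> a b w /size2[c [d [w' [-> sw]]]] nab; rewrite F0 // nab.
rewrite psum0 ?add0r; last first.
  move=> w pw; have /size2[c [d [w' [E sw]]]] : size w = k by rewrite (perm_size pw) size_iota.
  have cM : c \in M by rewrite -(perm_mem pw) E !inE eqxx.
  have dM : d \in M by rewrite -(perm_mem pw) E !inE eqxx orbT.
  by rewrite E F0 // (lt_mm cM dM) orbT.
have partb : \sum_(y <- M) psum (n :: rem y M) (fun w => F [:: 1%N, y & w]) =
    k.-2`!q * (t ^+ k.-1 * [q]q * [p + v]q + t ^+ (p + q) * [v]q * [(p + v).-1]q).
  transitivity (\sum_(y <- M) (p.+1 < y)%:R * t ^+ (y - 2) *
      (k.-2`!q * t ^+ (q - (p + v + 2 <= y)) * [p + v - (y < p + v + 2)]q)).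
    apply: eq_big_seq => y yM.
    have nrem : uniq (n :: rem y M) by apply: un; [exact: sub_rem | exact: u_rem].
    rewrite psum_head_cons // psum0 ?add0r; last first.
      move=> w pw; have sw := perm_size pw; rewrite size_rem // in sw.
      case: w pw sw => [|d w] pw /= sw; first by move: k_gt1; rewrite -subn_gt0 subn1 -sw.
      have sw' : size w = k.-2 by rewrite -[k.-2]/(k.-1.-1) -sw.
      have dM : d \in M by apply: (@sub_rem y); rewrite -(perm_mem pw) inE eqxx.
      by rewrite F0 ?lt_nm ?orbT.
    (* [z] runs over the middle letters below [n] in P; one of them is lost exactly when [y] is such
       a letter. *)
    have -> : [p + v - (y < p + v + 2)]q = \sum_(z <- rem y M) (z < p + v + 2)%:R *
        t ^+ count (fun d => d < z)%N (rem y M).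
      rewrite sum_rank; last exact: sorted_rem.
      by rewrite count_rem yM count_lt_iota ?addnK // /k; clear; lia.
    rewrite !mulr_sumr; apply: eq_big_seq => z zM.
    have zM' := mem_rem zM.
    have nrem2 : uniq (n :: rem z (rem y M)).
      by apply: un; [move=> c /mem_rem /mem_rem | do 2!apply: u_rem].
    have sub2 : sub (rem z (rem y M)) by move=> c /mem_rem /mem_rem.
    rewrite psum_head_cons // [X in _ + X]big_seq [X in _ + X]big1 ?addr0; last first.
      move=> d dM; have dM' := sub2 _ dM; apply: psum0 => w pw.
      rewrite F0 ?(lt_mm zM' dM') ?orbT //.
      rewrite (perm_size pw) /= seq.size_rem // size_rem2 // prednK //.
      by rewrite -(size_rem2 _ _ yM zM); case: (rem z (rem y M)) dM.
    rewrite -(size_rem2 _ _ yM zM) -inversions //; last by do 2!apply: sorted_rem.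
    have -> (A B C D E : R) : A * B * (C * D * E) = A * B * D * E * C by move=> *; ring.
    rewrite -psumZ; apply: eq_psum => w pw.
    have wM := sub_perm sub2 pw.
    have sw : size w = k.-2 by rewrite (perm_size pw) size_rem2.
    rewrite FE // lt_1m // lt_mn // /cr lt_m1 // lt_nm // path_mid //; last by move=> c cM; rewrite lt_mm.
    have [ltz|] := ltnP z (p + v + 2); last by rewrite andbF !(mul0r, mulr0).
    rewrite !andbT -[pairw _ _]/((\prod_(d <- [:: y, z, n & w]) h 1%N d) *
       ((\prod_(d <- [:: z, n & w]) h y d) * ((\prod_(d <- n :: w) h z d) *
        ((\prod_(d <- w) h n d) * pairw h w)))).
    rewrite prod_1; last first.
      by move=> c; rewrite !inE => /or4P[/eqP->|/eqP->|/eqP->|/wM->]; rewrite ?yM ?zM' ?eqxx ?orbT.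
    have pzw : perm_eq (z :: w) (rem y M).
      by rewrite perm_sym (perm_trans (perm_to_rem zM)) // perm_cons perm_sym.
    have zwM := sub_perm (@sub_rem y) pzw.
    have -> : \prod_(d <- [:: z, n & w]) h y d = t ^+ (y - 2).
      rewrite -(count_lt_rem yM) -(seq.permP pzw) -prod_mm // !big_cons h_mn //; ring.
    have -> : \prod_(d <- n :: w) h z d = t ^+ count (fun d => d < z)%N (rem y M).
      by rewrite -(seq.permP pzw) /= ltnn add0n big_cons h_mn // (prod_mm zM' wM) mul1r.
    have -> : \prod_(d <- w) h n d = t ^+ (q - (p + v + 2 <= y)).
      rewrite -(count_nbrn_rem yM) -(seq.permP pzw) /= (prod_nm wM).
      by rewrite [(_ <= z)%N]leqNgt ltz.
    by rewrite [true%:R * _]mul1r; ring.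
  rewrite sumM [X in X + _ + _]big_nat [X in X + _ + _]big1 ?add0r; last first.
    by move=> i lti; rewrite (_ : (p.+1 < i.+2)%N = false) ?mul0r //; move: lti; clear; lia.
  rewrite [RHS]mulrDr [RHS]addrC; congr (_ + _).
    rewrite -[[v]q]sum_expr_qnum !(mulr_sumr, mulr_suml); apply: eq_big_nat => i lti.
    rewrite (_ : (p.+1 < (p + i).+2)%N = true); last by clear; lia.
    rewrite (_ : (p + v + 2 <= (p + i).+2)%N = false); last by move: lti; clear; lia.
    rewrite (_ : ((p + i).+2 < p + v + 2)%N = true); last by move: lti; clear; lia.
    by rewrite subn0 subn1 subn2 /= !exprD; ring.
  rewrite -[[q]q]sum_expr_qnum !(mulr_sumr, mulr_suml); apply: eq_big_nat => i lti.
  rewrite (_ : (p.+1 < (p + v + i).+2)%N = true); last by clear; lia.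
  rewrite (_ : (p + v + 2 <= (p + v + i).+2)%N = true); last by clear; lia.
  rewrite (_ : ((p + v + i).+2 < p + v + 2)%N = false); last by clear; lia.
  have -> : k.-1 = (p + v + (q - 1))%N by rewrite /k; move: lti; clear; lia.
  by rewrite subn0 subn2 /= !exprD; ring.
rewrite partb [RHS]mulrDr; congr (_ + _).
transitivity (\sum_(a <- M) (a < p.+2)%:R * t ^+ count (fun d => d < a)%N M *
    (k.-2`!q * (t ^+ k * [q]q))); last first.
  by rewrite -mulr_suml sum_rank // count_nbr1; ring.
apply: eq_big_seq => a aM.
rewrite psum_head_cons ?u1 ?u_rem // [X in _ + X]big_seq [X in _ + X]big1 ?addr0; last first.
  move=> z zM; apply: psum0 => w pw; have sw := perm_size pw.
  rewrite /= size_rem2 // in sw.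
  case: w pw sw => // d w pw [sw].
  have : d \in 1%N :: rem z (rem a M) by rewrite -(perm_mem pw) inE eqxx.
  have zM' := mem_rem zM.
  rewrite inE => /predU1P[->|/mem_rem/mem_rem dM]; rewrite F0 ?sw //.
    by rewrite (lt_m1 zM') orbT.
  by rewrite (lt_mm zM' dM) orbT.
rewrite psum_head ?u_rem //; last by rewrite size_rem // -subn1 subn_gt0.
transitivity (\sum_(y <- rem a M) (a < p.+2)%:R * t ^+ count (fun d => d < a)%N M *
   (k.-2`!q * t ^+ q.+1) * ((p + v + 2 <= y)%:R * t ^+ count (fun d => d < y)%N (rem a M))).
  apply: eq_big_seq => y yM.
  have yM' := mem_rem yM.
  have sub2 : sub (rem y (rem a M)) by move=> c /mem_rem /mem_rem.
  rewrite -(size_rem2 _ _ aM yM) -inversions //; last by do 2!apply: sorted_rem.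
  have -> (A B C D E : R) : A * B * (C * D) * E = A * B * D * E * C by move=> *; ring.
  rewrite -psumZ; apply: eq_psum => w pw.
  have wM := sub_perm sub2 pw.
  have sw : size w = k.-2 by rewrite (perm_size pw) size_rem2.
  rewrite FE // lt_mn // lt_1m // /cr lt_1m // lt_mn // path_mid //.
  case: (ltnP a p.+2) => lta; last first.
    by rewrite /= !andbF !mul0r.
  case: (leqP (p + v + 2) y) => ley; last by rewrite /= !andbF !(mul0r, mulr0).
  rewrite (_ : (a < p + v + 2)%N); last by move: lta; clear; lia.
  rewrite (_ : (p.+1 < y)%N); last by move: ley; clear; lia.
  rewrite !mul1r -[pairw _ _]/((\prod_(d <- [:: n, 1%N, y & w]) h a d) *
       ((\prod_(d <- [:: 1%N, y & w]) h n d) * ((\prod_(d <- y :: w) h 1%N d) *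
        ((\prod_(d <- w) h y d) * pairw h w)))).
  rewrite prod_1; last first.
    by move=> c; rewrite !inE => /predU1P[->|/wM->]; rewrite ?yM' ?eqxx ?orbT.
  have pyw : perm_eq (y :: w) (rem a M).
    by rewrite perm_sym (perm_trans (perm_to_rem yM)) // perm_cons perm_sym.
  have ywM := sub_perm (@sub_rem a) pyw.
  have -> : \prod_(d <- [:: n, 1%N, y & w]) h a d = t * t ^+ count (fun d => d < a)%N M.
    rewrite !(big_cons _ _ n) !(big_cons _ _ 1%N) h_mn // h_m1 // lta mul1r; congr (_ * _).
    rewrite (prod_mm aM ywM) (seq.permP pyw) count_lt_rem // count_lt_iota //.
    by move: aM; rewrite memM /n; clear; lia.
  have -> : \prod_(d <- [:: 1%N, y & w]) h n d = t ^+ q.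
    rewrite big_cons h_n1 mul1r (prod_nm ywM) (seq.permP pyw) count_nbrn_rem //.
    by rewrite (_ : (p + v + 2 <= a)%N = false) ?subn0 //; move: lta; clear; lia.
  have -> : \prod_(d <- w) h y d = t ^+ count (fun d => d < y)%N (rem a M).
    by rewrite -(seq.permP pyw) /= ltnn add0n (prod_mm yM' wM).
  by rewrite exprS; ring.
rewrite -mulr_sumr; case: (ltnP a p.+2) => lta; last by rewrite !mul0r.
suff -> : \sum_(y <- rem a M) (p + v + 2 <= y)%:R * t ^+ count (fun d => d < y)%N (rem a M)
   = t ^+ (p + v).-1 * [q]q.
  rewrite (_ : k = (p + v).-1 + q.+1)%N ?exprD; first by ring.
  by rewrite /k; move: aM lta k_gt1; rewrite memM /n /k; clear; lia.
have srem := sorted_rem a sorted_M.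
have lt_an : (a < k.+2)%N by move: aM; rewrite memM => /andP[].
have lt_1a : (1 < a)%N by move: aM; rewrite memM => /andP[].
(* The sum over the neighbours of [n] is a difference of two initial sums, with bounds [n] and
   [p + v + 2], each given by [sum_rank]. *)
have E2 : \sum_(z <- rem a M) (z < p + v + 2)%:R * t ^+ count (fun d => d < z)%N (rem a M)
    = [(p + v).-1]q.
  rewrite sum_rank // count_rem aM count_lt_iota; last by rewrite /k; clear; lia.
  by rewrite addnK (_ : (a < p + v + 2)%N) ?subn1 //; move: lta; clear; lia.
have E1 : \sum_(z <- rem a M) (z < n)%:R * t ^+ count (fun d => d < z)%N (rem a M)
    = [(p + v).-1]q + t ^+ (p + v).-1 * [q]q.
  rewrite sum_rank // count_rem aM count_lt_iota; last by rewrite /n; clear; lia.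
  rewrite -qnumD; congr qnum; rewrite lt_an /n /k; move: lt_an lt_1a lta v_gt0; rewrite /k; clear.
  by move: p v q a => p' v' q' a'; lia.
rewrite -E2 in E1.
rewrite -[LHS](addKr (\sum_(z <- rem a M) (z < p + v + 2)%:R *
  t ^+ count (fun d => d < z)%N (rem a M))) -[RHS](addKr (\sum_(z <- rem a M)
  (z < p + v + 2)%:R * t ^+ count (fun d => d < z)%N (rem a M))); congr (_ + _).
rewrite -E1 -big_split; apply: eq_big_seq => z /mem_rem; rewrite memM /n => /andP[_ ltz] /=.
by rewrite ltz ltnNge; case: leqP => _; rewrite /= !(mul0r, mul1r, add0r, addr0).
Qed.

End TableauSums.

(** * The coefficients of the elementary expansion *)

Section Coefficients.
Context {R : comNzRingType} (t : R) (p w q : nat).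
Local Notation "[ k ]q" := (qnum t k) (at level 0, format "[ k ]q").
Local Notation "k `!q" := (qfact t k) (at level 2, format "k `!q").

(** This and the next three are the tableau sums at [v = w.+1], which removes predecessors from
    exponents and t-integers. *)
Definition coefB1 := (p + w + q).+1`!q * [p.+1]q * [q.+1]q.
Definition coefB21 := (p + w + q)`!q * (t ^+ q * [(p + w + q).+1]q
  + t ^+ p * [w.+1]q * [q.+1]q + t ^+ (p + w).+1 * [q]q * [q]q
  + t ^+ q.+1 * [(p + w).+1]q * [p]q).
Definition coefB31 := (p + w + q)`!q * (t ^+ (p + q) * [w.+1]q).
Definition coefB22 := (p + w + q).-1`!q * (t ^+ (p + w + q) * [q]q * [(p + w).+1]q
  + t ^+ (p + q) * [w.+1]q * [p + w]q + t ^+ (p + w + q).+1 * [p]q * [q]q).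

Hypothesis p_gt0 : (0 < p)%N.

Let qfact1 : (p + w + q)`!q = (p + w + q).-1`!q * [p + w + q]q.
Proof.
have [j ->] : exists j, (p + w + q = j.+1)%N by exists (p + w + q).-1; lia.
by rewrite qfactS.
Qed.

Let expand := (@qnumSl R, @qnumD R, @exprS R, @exprD R).
Let expand0 := (expr_qnum t p, expr_qnum t w, expr_qnum t q).

Lemma coefC22E : coefB22 - coefB31 =
  (p + w + q).-1`!q * (t ^+ (p + w + q) * (1 + t) * [p]q * [q]q).
Proof. by rewrite /coefB22 /coefB31 qfact1 !expand !expand0; ring. Qed.

Lemma coefC11E : coefB21 - coefB22 - coefB31 =
  (p + w + q).-1`!q * ([p]q * [(p + w + q).+2]q * t ^+ q * [p + w]q
                       + [q]q * [p + w + q]q * t ^+ p * [(w + q).+2]q).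
Proof. by rewrite /coefB21 /coefB22 /coefB31 qfact1 !expand !expand0; ring. Qed.

Lemma coefCnE : coefB1 - coefB21 + coefB31 =
  (p + w + q)`!q * ([(p + w + q).+3]q * [p]q * [q]q).
Proof. by rewrite /coefB1 /coefB21 /coefB31 qfactS qfact1 !expand !expand0; ring. Qed.

End Coefficients.

Section Expansion.
Context {R : idomainType} (t : R) (N : nat) (x : nat -> R) (p w q : nat).
Local Notation e := (elsym N x).
Let k := (p + w.+1 + q)%N.

Lemma chromatic_sum_elsym :
    (forall j, qnum t j.+1 != 0) -> (0 < p)%N -> (0 < q)%N ->
  \sum_(0 <= b < N) x b * (\sum_(0 <= a < N) x a *
     wsum N x k (fun u => pairw (ascw t) u * (\prod_(c <- take p u) ascw t a c)
                    * \prod_(c <- drop (p + w.+1) u) ascw t c b)) =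
  coefB31 t p w q * (e k * e 1 * e 1)
  + (coefB22 t p w q - coefB31 t p w q) * (e k * e 2)
  + (coefB21 t p w q - coefB22 t p w q - coefB31 t p w q) * (e k.+1 * e 1)
  + (coefB1 t p w q - coefB21 t p w q + coefB31 t p w q) * e k.+2.
Proof.
move=> q0 p_gt0 q_gt0.
have kE : k = (p + w + q).+1 by rewrite /k addnS addSn.
have qk : qnum t k != 0 by rewrite kE.
(* k - 1 = p + w + q is positive, so [k-1] may be cancelled along with [k]. *)
have qk1 : qnum t k.-1 != 0 by rewrite kE -[(_ + q)%N]prednK //=; lia.
apply: (mulfI qk1); apply: (mulfI qk).
rewrite chromatic_words // -/k coefC22E // coefC11E // coefCnE // /coefB31 kE [_.-1]/=.
have -> : qfact t (p + w + q).+1 = qfact t (p + w + q).-1 * qnum t (p + w + q) * qnum t (p + w + q).+1.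
  rewrite qfactS; congr (_ * _).
  by have [j ->] : exists j, (p + w + q = j.+1)%N; [exists (p + w + q).-1; lia | rewrite qfactS].
have -> : qfact t (p + w + q) = qfact t (p + w + q).-1 * qnum t (p + w + q).
  by have [j ->] : exists j, (p + w + q = j.+1)%N; [exists (p + w + q).-1; lia | rewrite qfactS].
move: (e 1) (e 2) (e _.+1) (e _.+2) (e _.+3) (qfact _ _) => e1 e2 ek ek1 ek2 f.
rewrite !(@qnumSl R, @qnumD R, @exprS R, @exprD R) !(expr_qnum t p, expr_qnum t w, expr_qnum t q).
ring.
Qed.

End Expansion.

(** * Specialisation to integer polynomials in t, and positivity *)

Import Num.Theory.

Lemma rmorph_qnum (R S : comNzRingType) (f : {rmorphism R -> S}) t k :
  f (qnum t k) = qnum (f t) k.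
Proof.
by elim: k => [|k IH]; rewrite ?qnum0 ?rmorph0 // !qnumS rmorphD IH rmorphXn.
Qed.

Lemma rmorph_qfact (R S : comNzRingType) (f : {rmorphism R -> S}) t k :
  f (qfact t k) = qfact (f t) k.
Proof.
by elim: k => [|k IH]; rewrite ?qfact0 ?rmorph1 // !qfactS rmorphM IH rmorph_qnum.
Qed.

(** Its value at t = 0 is 1. *)
Lemma qnum_tvar_neq0 N k : qnum (tvar N) k.+1 != 0.
Proof.
rewrite -(rmorph_qnum (@mpolyC N {poly int})) mpolyC_eq0 qnumSl.
apply/eqP => /(congr1 (fun P : {poly int} => P.[0])).
by rewrite !hornerE.
Qed.

Section NonnegCoefficients.
Implicit Types P Q : {poly int}.

Definition nonneg_coefs P := forall i, (0 : int) <= P`_i.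

Lemma nonneg_coefsD P Q : nonneg_coefs P -> nonneg_coefs Q -> nonneg_coefs (P + Q).
Proof. by move=> nP nQ i; rewrite coefD addr_ge0. Qed.

Lemma nonneg_coefsM P Q : nonneg_coefs P -> nonneg_coefs Q -> nonneg_coefs (P * Q).
Proof. by move=> nP nQ i; rewrite coefM; apply: sumr_ge0 => j _; rewrite mulr_ge0. Qed.

Lemma nonneg_coefs0 : nonneg_coefs 0.
Proof. by move=> i; rewrite coef0. Qed.

Lemma nonneg_coefs1 : nonneg_coefs 1.
Proof. by move=> i; rewrite coef1 ler0n. Qed.

Lemma nonneg_coefsX : nonneg_coefs 'X.
Proof. by move=> i; rewrite coefX ler0n. Qed.

Lemma nonneg_coefsXn k : nonneg_coefs ('X ^+ k).
Proof. by move=> i; rewrite coefXn ler0n. Qed.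

Lemma nonneg_coefs_qnum k : nonneg_coefs (qnum 'X k).
Proof.
elim: k => [|k IH]; first exact: nonneg_coefs0.
by rewrite qnumS; apply: nonneg_coefsD => //; exact: nonneg_coefsXn.
Qed.

Lemma nonneg_coefs_qfact k : nonneg_coefs (qfact 'X k).
Proof.
elim: k => [|k IH]; first exact: nonneg_coefs1.
by rewrite qfactS; apply: nonneg_coefsM => //; exact: nonneg_coefs_qnum.
Qed.

End NonnegCoefficients.

Lemma Bpoly_tabsum n m p v q la :
    n = (p + v + q).+2 ->
    (forall i, (1 <= i <= n - 1)%N -> (i <= m i <= n)%N) -> sumn la = n ->
  Bpoly n m la = tabsum p v q (invw m) (Plt n m) la.
Proof.
move=> En nat_m sla; rewrite (Bpoly_psum nat_m sla); subst n.
apply: psum_perm; first exact: iota_uniq.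
have -> : iota 1 (p + v + q).+2 = 1%N :: (iota 2 (p + v + q) ++ [:: (p + v + q).+2]).
  by rewrite -[LHS]/(1%N :: iota 2 (p + v + q).+1) -[in LHS](addn1 (p + v + q)) iotaD add2n.
by rewrite perm_cons perm_catC.
Qed.

Theorem theorem3p7 (n r s : nat) (m : nat -> nat) :
  (5 <= n)%N ->
  (* natural unit interval order P(m_1,...,m_{n-1}) *)
  (forall i, (1 <= i)%N -> (i < n - 1)%N -> (m i <= m i.+1)%N) ->
  (forall i, (1 <= i <= n - 1)%N -> (i <= m i <= n)%N) ->
  (* the specific shape of m *)
  m 1%N = r -> (2 <= r)%N -> (r < s)%N -> (s < n - 1)%N ->
  (forall i, (2 <= i <= s)%N -> m i = (n - 1)%N) ->
  (forall i, (s + 1 <= i <= n - 1)%N -> m i = n) ->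
  let B := Bpoly n m in
  let l1 := nseq n 1%N in
  let l21 := (2 :: nseq (n - 2) 1)%N in
  let l22 := (2 :: 2 :: nseq (n - 4) 1)%N in
  let l31 := (3 :: nseq (n - 3) 1)%N in
  let C211 := B l31 in
  let C22 := B l22 - B l31 in
  let C11 := B l21 - B l22 - B l31 in
  let Cn := B l1 - B l21 + B l31 in
  (forall N : nat,
     chromQ n N m =
       B l1 *: schur N l1 + B l21 *: schur N l21 + B l22 *: schur N l22
       + B l31 *: schur N l31
   /\ chromQ n N m =
       C211 *: elem N [:: (n - 2)%N; 1%N; 1%N] + C22 *: elem N [:: (n - 2)%N; 2%N]
       + C11 *: elem N [:: (n - 1)%N; 1%N] + Cn *: elem N [:: n])
  /\ (forall k : nat, 0 <= C211`_k /\ 0 <= C22`_k /\ 0 <= C11`_k /\ 0 <= Cn`_k).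
Proof.
move=> n_ge5 _ nat_m m1 r_ge2 ltrs ltsn m_lo m_hi B l1 l21 l22 l31 C211 C22 C11 Cn.
(* Vertex 1 has the neighbours 2, ..., r, and vertex n the neighbours s + 1, ..., n - 1; the s - r =
   [w.+1] vertices between are adjacent to neither. *)
pose p := r.-1; pose w := (s - r).-1; pose q := (n - 1 - s)%N; pose k := (p + w.+1 + q)%N.
have En : n = k.+2 by rewrite /k /p /w /q; lia.
have p_gt0 : (0 < p)%N by rewrite /p; lia.
have q_gt0 : (0 < q)%N by rewrite /q; lia.
have kE : k = (p + w + q).+1 by rewrite /k addnS addSn.
have Er : r = p.+1 by rewrite /p; lia.
have Es : s = (p + w).+2 by rewrite /p /w; lia.
have k_gt0 : (0 < k)%N by rewrite kE.
have k_gt1 : (1 < k)%N by rewrite kE; move: p_gt0; clear; lia.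
have m_mid i : (2 <= i < n)%N -> m i = if (i <= s)%N then k.+1 else k.+2.
  move=> lti; case: leqP => leis; first by rewrite m_lo; [rewrite En subn1 | lia].
  by rewrite m_hi //; lia.
have inM c : c \in iota 2 k -> (2 <= c < n)%N by rewrite mem_iota En add2n.
have edge1 c : incedge m 1 c = (1 < c <= p.+1)%N by rewrite /incedge m1 Er.
have edge_mid c d : (2 <= c < n)%N -> (2 <= d < n)%N -> incedge m c d = (c < d)%N.
  by move=> cM dM; rewrite /incedge m_mid // En in dM *; case: ifP => _; lia.
have edge_n c : (2 <= c < n)%N -> incedge m c n = (p + w.+1 + 2 <= c)%N.
  by move=> cM; rewrite /incedge m_mid //; move: cM; rewrite En Es; case: ifP; lia.
have edge_n1 c : (c <= n)%N -> incedge m n c = false by rewrite /incedge; lia.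
have edge_c1 c : (0 < c)%N -> incedge m c 1 = false by rewrite /incedge; lia.
have lt1 c : (c <= n)%N -> Plt n m 1 c = (p.+1 < c)%N.
  by move=> lec; rewrite /Plt m1 Er lec andbT; lia.
have lt_mid c d : (2 <= c < n)%N -> (d <= k.+1)%N -> Plt n m c d = false.
  by move=> cM dM; rewrite /Plt m_mid //; case: ifP => _; lia.
have lt_midn c : (2 <= c < n)%N -> Plt n m c n = (c < p + w.+1 + 2)%N.
  by move=> cM; rewrite /Plt m_mid //; move: cM; rewrite En Es; case: ifP; lia.
have lt_n c : Plt n m n c = false by rewrite /Plt ltnn.
have h_mm : {in iota 2 k &, forall c d, invw m c d = if (d < c)%N then 'X else 1}.
  by move=> c d /inM cM /inM dM; rewrite /invw edge_mid.
have h_m1 : {in iota 2 k, forall c, invw m c 1 = if (c < p.+2)%N then 'X else 1}.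
  by move=> c /inM cM; rewrite /invw edge1; case/andP: cM => -> _.
have h_nm : {in iota 2 k, forall c, invw m k.+2 c = if (p + w.+1 + 2 <= c)%N then 'X else 1}.
  by move=> c /inM cM; rewrite -En /invw edge_n.
have h_1m : {in iota 2 k, forall c, invw m 1 c = 1}.
  by move=> c /inM cM; rewrite /invw edge_c1 //; lia.
have h_mn : {in iota 2 k, forall c, invw m c k.+2 = 1}.
  by move=> c /inM cM; rewrite -En /invw edge_n1 //; lia.
have h_1n : invw m 1 k.+2 = 1 by rewrite -En /invw edge_n1 //; lia.
have h_n1 : invw m k.+2 1 = 1.
  by rewrite -En /invw edge1 ifF // En; apply/negbTE; rewrite kE; lia.
have lt_mm : {in iota 2 k &, forall c d, Plt n m c d = false}.
  by move=> c d /inM cM /inM dM; rewrite lt_mid //; lia.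
have lt_1m : {in iota 2 k, forall c, Plt n m 1 c = (p.+1 < c)%N}.
  by move=> c /inM cM; rewrite lt1 //; lia.
have lt_mn : {in iota 2 k, forall c, Plt n m c k.+2 = (c < p + w.+1 + 2)%N}.
  by move=> c /inM cM; rewrite -En lt_midn.
have lt_m1 : {in iota 2 k, forall c, Plt n m c 1 = false}.
  by move=> c /inM cM; rewrite lt_mid.
have lt_nm : {in iota 2 k, forall c, Plt n m k.+2 c = false}.
  by move=> c _; rewrite -En lt_n.
have lt_1n : Plt n m 1 k.+2 by rewrite -En lt1 // En kE; lia.
have lt_n1 : Plt n m k.+2 1 = false by rewrite -En lt_n.
have EB1 : B l1 = coefB1 'X p w q.
  rewrite /B /l1 (Bpoly_tabsum (v := w.+1) (p := p) (q := q) En nat_m) ?sumn_nseq ?mul1n //.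
  by rewrite [X in nseq X _]En (tabsum_1 (t := 'X)) // /coefB1 -/k kE.
have EB21 : B l21 = coefB21 'X p w q.
  have sl : sumn l21 = n by rewrite /l21 /= sumn_nseq; lia.
  rewrite /B (Bpoly_tabsum (v := w.+1) (p := p) (q := q) En nat_m sl) /l21.
  rewrite (_ : n - 2 = k)%N ?(tabsum_21 (t := 'X)) //; last by rewrite En subn2.
  by rewrite /coefB21 -/k kE /= addnS.
have EB31 : B l31 = coefB31 'X p w q.
  have sl : sumn l31 = n by rewrite /l31 /= sumn_nseq; lia.
  rewrite /B (Bpoly_tabsum (v := w.+1) (p := p) (q := q) En nat_m sl) /l31.
  rewrite (_ : n - 3 = k.-1)%N ?(tabsum_31 (t := 'X)) //; last by rewrite En subSS subn2.
  by rewrite /coefB31 -/k kE.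
have EB22 : B l22 = coefB22 'X p w q.
  have sl : sumn l22 = n by rewrite /l22 /= sumn_nseq; lia.
  rewrite /B (Bpoly_tabsum (v := w.+1) (p := p) (q := q) En nat_m sl) /l22.
  rewrite (_ : n - 4 = k.-2)%N ?(tabsum_22 (t := 'X)) //; last by rewrite En !subSS subn2.
  by rewrite /coefB22 -/k kE /= addnS.
split=> [N|]; last first.
  suff [n1 n2 n3 n4] : [/\ nonneg_coefs C211, nonneg_coefs C22, nonneg_coefs C11 & nonneg_coefs Cn].
    by move=> j; split; [exact: n1 | split; [exact: n2 | split; [exact: n3 | exact: n4]]].
  rewrite /C211 /C22 /C11 /Cn EB1 EB21 EB22 EB31 coefC22E // coefC11E // coefCnE // /coefB31.
  split; repeat first [exact: nonneg_coefs_qfact | exact: nonneg_coefs_qnum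
    | exact: nonneg_coefsXn | exact: nonneg_coefs1 | exact: nonneg_coefsX
    | apply: nonneg_coefsM | apply: nonneg_coefsD].
pose e := elsym N (mvar N).
have elem1 i : elem N [:: i] = e i by rewrite /elem big_seq1 mesym_elsym.
have elem2 i j : elem N [:: i; j] = e i * e j by rewrite /elem big_cons big_seq1 !mesym_elsym.
have elem3 i j l : elem N [:: i; j; l] = e i * e j * e l.
  by rewrite /elem !big_cons big_nil !mesym_elsym mulr1 mulrA.
have [c1 c21 c22 c31] : [/\ (coefB1 'X p w q)%:MP_[N] = coefB1 (tvar N) p w q,
    (coefB21 'X p w q)%:MP_[N] = coefB21 (tvar N) p w q,
    (coefB22 'X p w q)%:MP_[N] = coefB22 (tvar N) p w q &
    (coefB31 'X p w q)%:MP_[N] = coefB31 (tvar N) p w q].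
  rewrite /coefB1 /coefB21 /coefB22 /coefB31.
  by rewrite !(rmorphM, rmorphD, rmorphXn, rmorph_qnum, rmorph_qfact).
have chromE : chromQ n N m = C211 *: elem N [:: (n - 2)%N; 1%N; 1%N]
     + C22 *: elem N [:: (n - 2)%N; 2%N] + C11 *: elem N [:: (n - 1)%N; 1%N]
     + Cn *: elem N [:: n].
  have ed1 j : (j < k)%N -> incedge m 1 j.+2 = (j < p)%N by rewrite edge1; clear; lia.
  have ed1n : incedge m 1 n = false by rewrite edge1 En kE; clear; lia.
  have edm i j : (i < k)%N -> (j < k)%N -> incedge m i.+2 j.+2 = (i < j)%N.
    by move=> ltik ltjk; rewrite edge_mid ?En.
  have edn i : (i < k)%N -> incedge m i.+2 n = (p + w.+1 <= i)%N.
    by move=> ltik; rewrite edge_n ?En // addn2.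
  rewrite (chromQ_words N En ed1 ed1n edm edn).
  rewrite chromatic_sum_elsym //; last exact: qnum_tvar_neq0.
  rewrite -/k elem1 !elem2 elem3 -!mul_mpolyC /C211 /C22 /C11 /Cn EB1 EB21 EB22 EB31.
  by rewrite !(mpolyCB, mpolyCD) c1 c21 c22 c31 -/e En subn1 subn2.
(* Substituting the elementary expressions of the four Schur functions and collecting terms produces
   exactly the combinations of the B that define the C. *)
split=> //; rewrite chromE elem1 !elem2 elem3 !schur_schurw /l1 /l21 /l22 /l31.
rewrite schurw_1 schurw_21 schurw_22 schurw_31 -!mul_mpolyC -/e.
have -> : (n - 4).+2 = (n - 2)%N by move: n_ge5; clear; lia.
have -> : (n - 3).+1 = (n - 2)%N by move: n_ge5; clear; lia.
have -> : (n - 2).+1 = (n - 1)%N by move: n_ge5; clear; lia.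
have -> : (n - 1).+1 = n by move: n_ge5; clear; lia.
rewrite /C211 /C22 /C11 /Cn !(mpolyCB, mpolyCD).
ring.
Qed.
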